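(* A partial function $F:\subseteq\mathbb{N}^{\mathbb{N}}\to\mathbb{N}^{\mathbb{N}}$ is low if and only if $G\circ F$ is limit computable for every limit computable $G:\subseteq\mathbb{N}^{\mathbb{N}}\to\mathbb{N}^{\mathbb{N}}$.
   Context: $F:\subseteq A\to B$ denotes a partial function, and compositions have their natural domain $\mathrm{dom}(G\circ F)=\{p\in\mathrm{dom}(F):F(p)\in\mathrm{dom}(G)\}$. Coding: $\langle n,k\rangle:=\frac12(n+k)(n+k+1)+k$ for $n,k\in\mathbb{N}$, and $\langle p_0,p_1,p_2,\dots\rangle\langle n,k\rangle:=p_n(k)$ for $p_i\in\mathbb{N}^{\mathbb{N}}$. A partial function $F:\subseteq\mathbb{N}^{\mathbb{N}}\to\mathbb{N}^{\mathbb{N}}$ is computable if there is a Turing machine (infinite input tape, one-way output tape) that on each input $p\in\mathrm{dom}(F)$ produces $F(p)$ in the long run; nothing is required outside $\mathrm{dom}(F)$. $F$ is limit computable if there is a Turing machine with a two-way output tape (it may revise its output) that on each input $p\in\mathrm{dom}(F)$ computes $F(p)$ in the long run such that for every output position $n\in\mathbb{N}$, after finitely many steps the content of that position is $F(p)(n)$ and is never changed again; nothing is required outside $\mathrm{dom}(F)$. The limit map is $\lim:\subseteq\mathbb{N}^{\mathbb{N}}\to\mathbb{N}^{\mathbb{N}}$, $\langle p_0,p_1,p_2,\dots\rangle\mapsto\lim_{i\to\infty}p_i$ (limit in the product topology, domain: convergent sequences). The Turing jump $\mathsf{J}:\mathbb{N}^{\mathbb{N}}\to\mathbb{N}^{\mathbb{N}}$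 is defined by $\mathsf{J}(p)(i)=1$ if the $i$-th Turing machine halts upon input $p$, and $\mathsf{J}(p)(i)=0$ otherwise. $\mathsf{J}$ is injective, and $\mathsf{J}^{-1}:\subseteq\mathbb{N}^{\mathbb{N}}\to\mathbb{N}^{\mathbb{N}}$ is its partial inverse. Let $\mathsf{L}:=\mathsf{J}^{-1}\circ\lim$. A function $F:\subseteq\mathbb{N}^{\mathbb{N}}\to\mathbb{N}^{\mathbb{N}}$ is called low if there is a computable $G:\subseteq\mathbb{N}^{\mathbb{N}}\to\mathbb{N}^{\mathbb{N}}$ with $F=\mathsf{L}\circ G$. *)

(* Defs.v *)
From mathcomp Require Import all_boot.
From mathcomp Require Import boolp classical_sets functions.
From mathcomp Require Import topology function_spaces.

Set Implicit Arguments.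
Unset Strict Implicit.
Unset Printing Implicit Defensive.

Local Open Scope classical_set_scope.

Definition baire : Type := nat -> nat.

(* [F p = Some q] means that p is in dom(F) and F(p) = q. *)
Definition pfun : Type := baire -> option baire.

Definition pcomp (G F : pfun) : pfun := fun p => obind G (F p).

(* The partial inverse of f, meant for injective f: for other f the value is
   some chosen preimage. *)
Definition partial_inverse (f : baire -> baire) : pfun := fun q =>
  if `[< exists p : baire, f p = q >]
  then Some (get [set p : baire | f p = q]) else None.

Definition cantor (n k : nat) : nat := ((n + k) * (n + k).+1)./2 + k.

Definition uncantor_next (x : nat * nat) : nat * nat :=
  if x.1 is n.+1 then (n, x.2.+1) else (x.2.+1, 0).

Definition uncantor (c : nat) : nat * nat := iter c uncantor_next (0, 0).

Lemma cantor_next x : cantor (uncantor_next x).1 (uncantor_next x).2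
                      = (cantor x.1 x.2).+1.
Proof.
case: x => [[|n] k] /=; rewrite /cantor ?add0n ?addn0.
  have -> : k.+1 * k.+2 = k * k.+1 + k.+1.*2 by rewrite -muln2 [k * _]mulnC -mulnDr addn2.
  by rewrite halfD odd_double andbF add0n doubleK addnS.
by rewrite addnS addSn addnS.
Qed.

Lemma uncantorK c : cantor (uncantor c).1 (uncantor c).2 = c.
Proof.
by elim: c => [//|c IH]; rewrite /uncantor iterS -/(uncantor c) cantor_next IH.
Qed.

Lemma uncantor_diag s k : k <= s ->
  iter k uncantor_next (s, 0) = (s - k, k).
Proof.
elim: k => [|k IH] ks; first by rewrite subn0.
by rewrite iterS IH 1?ltnW// /uncantor_next/= -(subnSK ks).
Qed.

Lemma cantorK n k : uncantor (cantor n k) = (n, k).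
Proof.
suff tri s : uncantor ((s * s.+1)./2) = (s, 0).
  by rewrite /uncantor /cantor addnC iterD -/(uncantor _) tri uncantor_diag
             ?leq_addl// addnK.
elim: s => [//|s IH].
have -> : (s.+1 * s.+2)./2 = s.+1 + (s * s.+1)./2.
  have -> : s.+1 * s.+2 = s.+1.*2 + s * s.+1.
    by rewrite -muln2 [s * _]mulnC -mulnDr add2n.
  by rewrite halfD odd_double add0n doubleK.
by rewrite /uncantor iterD -/(uncantor _) IH iterS uncantor_diag// subnn.
Qed.

Definition rows (p : baire) (n : nat) : baire := fun k => p (cantor n k).

(* Convergence in the product topology, [nat] being discrete; the limit is
   unique since this topology is Hausdorff. *)
Definition limB : pfun := fun p =>
  if `[< exists q : baire, {ptws, rows p @ \oo --> q} >]
  then Some (get [set q : baire | {ptws, rows p @ \oo --> q}]) else None.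

(* Tape symbols are numbers, 0 being the blank; a machine uses only the finitely
   many symbols and states that occur in its finite table. *)
Notation blank := 0 (only parsing).
Notation one := 1 (only parsing).
Notation sep := 2 (only parsing).

(* The sequence p is written on a tape as the infinite word
   one^(p 0) sep one^(p 1) sep one^(p 2) sep ... *)
Definition word (p : baire) (c : nat) : nat :=
  if [exists n : 'I_c.+1, c.+1 == \sum_(i < n.+1) (p i).+1] then sep else one.

(* Tapes are infinite to the right; moving left from cell 0 has no effect. *)
Inductive move := Left | Stay | Right.

Definition move_head (m : move) (h : nat) : nat :=
  match m with Left => h.-1 | Stay => h | Right => h.+1 end.

Record tape := Tape { cell : nat -> nat; pos : nat }.

Definition blank_tape : tape := Tape (fun=> blank) 0.

Definition scan (T : tape) : nat := cell T (pos T).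

Definition act (w : option nat) (m : move) (T : tape) : tape :=
  Tape (if w is Some a then fun c => if c == pos T then a else cell T c
        else cell T)
       (move_head m (pos T)).

(* An entry of the table of a machine with k work tapes, a read-only input tape
   and a write-only output tape. *)
Record rule (k : nat) := Rule {
  src : nat;
  rd_in : nat;
  rd_work : {ffun 'I_k -> nat};
  dst : nat;
  mv_in : move;
  wr_work : {ffun 'I_k -> nat};
  mv_work : {ffun 'I_k -> move};
  wr_out : option nat;
  mv_out : move }.

(* The initial state is 0. The first applicable rule is executed, and the
   machine halts when there is none. *)
Record machine := Machine { tapes : nat; rules : seq (rule tapes) }.

Record config (k : nat) := Config {
  state : nat;
  in_head : nat;
  work : 'I_k -> tape;
  out : tape }.

(* Cell 0 of the input tape is blank, so that its left end can be detected. *)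
Definition in_cell (p : baire) (c : nat) : nat :=
  if c is c'.+1 then word p c' else blank.

Definition applicable k (p : baire) (C : config k) (r : rule k) : bool :=
  [&& src r == state C, rd_in r == in_cell p (in_head C)
    & [forall j, rd_work r j == scan (work C j)]].

Definition execute k (C : config k) (r : rule k) : config k :=
  Config (dst r) (move_head (mv_in r) (in_head C))
         (fun j => act (Some (wr_work r j)) (mv_work r j) (work C j))
         (act (wr_out r) (mv_out r) (out C)).

Definition step (M : machine) (p : baire) (C : config (tapes M)) :
    option (config (tapes M)) :=
  omap (execute C) (ohead [seq r <- rules M | applicable p C r]).

Definition init (M : machine) : config (tapes M) :=
  Config 0 0 (fun=> blank_tape) blank_tape.

Definition run (M : machine) (p : baire) (t : nat) : config (tapes M) :=
  iter t (fun C => odflt C (step p C)) (init M).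

Definition halts (M : machine) (p : baire) : Prop :=
  exists t, step p (run M p t) = None.

(* Every position of the output tape eventually has, forever, the content that
   it has in the word of F(p). *)
Definition produces (M : machine) (F : pfun) : Prop :=
  forall p q, F p = Some q ->
  forall c, exists t0, forall t, t0 <= t -> cell (out (run M p t)) c = word q c.

(* On a one-way output tape the head moves right after each written symbol and
   does not move otherwise; in particular no written symbol is ever revised. *)
Definition one_way (M : machine) : bool :=
  all (fun r => match wr_out r, mv_out r with
                | Some _, Right | None, Stay => true
                | _, _ => false
                end) (rules M).

Definition computable (F : pfun) : Prop :=
  exists2 M : machine, one_way M & produces M F.

Definition limit_computable (F : pfun) : Prop :=
  exists M : machine, produces M F.

(* [entry c i] is the i-th entry of the sequence coded by c, where
   c = <entry 0, <entry 1, <entry 2, ...>>>. *)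
Definition entry (c i : nat) : nat :=
  (uncantor (iter i (fun d => (uncantor d).2) c)).1.

Definition move_of_nat (n : nat) : move :=
  match n with 0 => Left | 1 => Stay | _ => Right end.

Definition option_of_nat (n : nat) : option nat :=
  if n is a.+1 then Some a else None.

Definition rule_of_nat (k c : nat) : rule k :=
  Rule (entry c 0) (entry c 1) [ffun j : 'I_k => entry (entry c 2) j]
       (entry c 3) (move_of_nat (entry c 4))
       [ffun j : 'I_k => entry (entry c 5) j]
       [ffun j : 'I_k => move_of_nat (entry (entry c 6) j)]
       (option_of_nat (entry c 7)) (move_of_nat (entry c 8)).

(* A numbering of all machines, see [machine_of_nat_onto]; halting does
   not depend on the output, so two-way machines are included. *)
Definition machine_of_nat (i : nat) : machine :=
  Machine [seq rule_of_nat (entry i 0) (entry (entry i 2) j)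
          | j <- iota 0 (entry i 1)].

Lemma entry_onto (s : seq nat) : exists c, forall i, i < size s ->
  entry c i = nth 0 s i.
Proof.
elim: s => [|a s [c IH]]; first by exists 0.
exists (cantor a c) => -[_|i /IH /= <-]; first by rewrite /entry cantorK.
by rewrite /entry iterSr cantorK.
Qed.

Lemma entry_onto_ffun k (f : {ffun 'I_k -> nat}) :
  exists c, forall j : 'I_k, entry c j = f j.
Proof.
have [c cE] := entry_onto [tuple f j | j < k].
by exists c => j; rewrite cE ?size_tuple// -tnth_nth tnth_mktuple.
Qed.

Lemma rule_of_nat_onto k (r : rule k) : exists c, rule_of_nat k c = r.
Proof.
pose mn m := match m with Left => 0 | Stay => 1 | Right => 2 end.
have mnK : cancel mn move_of_nat by case.
case: r => s ri rw d mi ww mw wo mo.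
have [c2 c2E] := entry_onto_ffun rw.
have [c5 c5E] := entry_onto_ffun ww.
have [c6 c6E] := entry_onto_ffun [ffun j => mn (mw j)].
have [c cE] := entry_onto [:: s; ri; c2; d; mn mi; c5; c6;
                             if wo is Some a then a.+1 else 0; mn mo].
exists c; rewrite /rule_of_nat !cE//= !mnK.
congr Rule; try by apply/ffunP => j; rewrite ffunE.
  by apply/ffunP => j; rewrite ffunE c6E ffunE mnK.
by case: wo {cE}.
Qed.

Lemma machine_of_nat_onto (M : machine) : exists i, machine_of_nat i = M.
Proof.
case: M => k rs.
have [s sE] : exists s, [seq rule_of_nat k c | c <- s] = rs.
  elim: rs => [|r rs [s <-]]; first by exists [::].
  by have [c <-] := rule_of_nat_onto r; exists (c :: s).
have [c cE] := entry_onto s.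
have [i iE] := entry_onto [:: k; size s; c].
exists i; rewrite /machine_of_nat !iE//= -sE; congr Machine.
apply: (@eq_from_nth _ (rule_of_nat k 0)) => [|j]; rewrite !size_map size_iota//.
by move=> js; rewrite !(nth_map 0) ?size_iota// nth_iota// cE.
Qed.

Definition jump (p : baire) : baire :=
  fun i => `[< halts (machine_of_nat i) p >].

Definition lowmap : pfun := pcomp (partial_inverse jump) limB.

Definition low (F : pfun) : Prop :=
  exists2 G : pfun, computable G & F =1 pcomp lowmap G.

(* Main.v *)
(* A machine that runs for t steps sees at most t cells of its input, so F is
   limit computable if and only if the cells of the word of F(p) are the limits
   of a primitive recursive function of the prefixes of p; primitive recursive
   functions are run on machines through counter programs, and machines are
   simulated by primitive recursive functions.

   The jump is limit computable, since halting is the limit of halting within t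
   steps.  If its composition with F is limit computable, then a one-way machine
   that prints stage after stage of the approximations of J(F(p)) shows that F is
   low.  Conversely, let j_s converge to J(F(p)) and let G be limit computable.
   Uniformly in c, s and a there is a machine that halts on q if and only if cell
   c of the output of G on q differs from a at some time after s; its number is a
   primitive recursive function of c, s and a.  The first (s, a) for which J(q)
   denies this gives the c-th symbol of G(q), and by replacing J(q), q = F(p),
   with its approximations one obtains approximations of that symbol. *)
From HB Require Import structures.
From mathcomp Require Import all_boot.
From mathcomp Require Import boolp classical_sets functions.
From mathcomp Require Import topology function_spaces.
From mathcomp Require Import zify.
Require Import Defs.

Set Implicit Arguments.
Unset Strict Implicit.
Unset Printing Implicit Defensive.

(** * Counter programs *)

(** The obstacle is uniformity: one implication needs the number of a machine as a primitive
    recursive function of parameters, hence explicit tables. A single kind of machine, the driver,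
    serves all purposes. At each stage it reads one more input cell, evaluates a fixed primitive
    recursive function at a parameter and the prefix read so far, and takes the value as an order:
    do nothing, print [one], print [sep], step back, or stop. The parameter enters the table as a
    chain of states, so only a regular piece of the table depends on it. A counter is a work tape
    with cell 0 marked, its value being the position of the head, so that zero is visible in the
    scanned symbol. The question put to the jump is whether a cell ever changes away from a value,
    because a negative answer is about all later times and so fixes the limit. A pair with negative
    answer exists as the cell converges, and taking the least one lets finitely many bits of the
    jump decide the symbol. *)

Inductive cmd :=
  | Skip
  | Inc of nat
  | Dec of nat
  | Put of nat
  | Back
  | Seq of cmd & cmd
  | If of nat & cmd & cmd
  | While of nat & cmd
  | Get of cmd & cmd & cmd.

HB.instance Definition _ := gen_eqMixin cmd.

(* The control state is the list of the commands that remain to be executed. *)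
Record conf := Conf {
  prog : seq cmd;
  regs : nat -> nat;
  inp : nat;
  outp : tape }.

Definition next (K : seq cmd) (z : nat -> bool) (a : nat) : seq cmd :=
  match K with
  | [::] => [::]
  | Seq c1 c2 :: K' => [:: c1, c2 & K']
  | If r c1 c2 :: K' => (if z r then c2 else c1) :: K'
  | While r c :: K' => if z r then K' else c :: K
  | Get c0 c1 c2 :: K' => (match a with 0 => c0 | 1 => c1 | _ => c2 end) :: K'
  | _ :: K' => K'
  end.

Definition reg_move (K : seq cmd) (j : nat) : move :=
  match K with
  | Inc r :: _ => if j == r then Right else Stay
  | Dec r :: _ => if j == r then Left else Stay
  | _ => Stay
  end.

Definition inp_move (K : seq cmd) : move :=
  if K is Get _ _ _ :: _ then Right else Stay.

Definition out_write (K : seq cmd) : option nat :=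
  if K is Put a :: _ then Some a else None.

Definition out_move (K : seq cmd) : move :=
  match K with Put _ :: _ => Right | Back :: _ => Left | _ => Stay end.

Definition cstep (p : baire) (C : conf) : conf :=
  Conf (next (prog C) (fun r => regs C r == 0) (in_cell p (inp C)))
       (fun j => move_head (reg_move (prog C) j) (regs C j))
       (move_head (inp_move (prog C)) (inp C))
       (act (out_write (prog C)) (out_move (prog C)) (outp C)).

Lemma act_stay T : act None Stay T = T.
Proof. by case: T. Qed.

(** The output may change at the last step only. Between two stages of the driver no intermediate
    contents then appear, and the stages alone govern the limit of the tape. *)
Definition reach (p : baire) (n : nat) (C C' : conf) : Prop :=
  iter n (cstep p) C = C' /\
  forall m, m < n -> outp (iter m (cstep p) C) = outp C.

Lemma reach_trans p n m C C' C'' : outp C' = outp C ->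
  reach p n C C' -> reach p m C' C'' -> reach p (n + m) C C''.
Proof.
move=> oC [CC' oCC'] [C'C'' oC'C'']; split; first by rewrite addnC iterD CC'.
move=> i; case: (ltnP i n) => [/oCC'//|ni] im.
by rewrite -(subnK ni) iterD CC' oC'C'' ?ltn_subLR.
Qed.

Lemma reach_step p n C C' : outp (cstep p C) = outp C ->
  reach p n (cstep p C) C' -> reach p n.+1 C C'.
Proof. by move=> oC; rewrite -add1n; apply: reach_trans => //; split=> // -[]. Qed.

(** Total correctness: under any continuation, input and output the command terminates and affects
    nothing but the registers. *)
Definition quiet (c : cmd) (s s' : nat -> nat) : Prop :=
  forall p K h o, exists n, reach p n.+1 (Conf (c :: K) s h o) (Conf K s' h o).

Lemma quiet1 c s s' :
  (forall p K h o, cstep p (Conf (c :: K) s h o) = Conf K s' h o) -> quiet c s s'.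
Proof. by move=> E p K h o; exists 0; split; [exact: E | case]. Qed.

Lemma quiet_jump c c1 s s' :
  (forall p K h o, cstep p (Conf (c :: K) s h o) = Conf (c1 :: K) s h o) ->
  quiet c1 s s' -> quiet c s s'.
Proof.
move=> E q p K h o; have [n qn] := q p K h o.
by exists n.+1; apply: reach_step; rewrite E.
Qed.

Lemma quiet_skip s : quiet Skip s s.
Proof. by apply: quiet1 => p K h o; rewrite /cstep/= act_stay. Qed.

Lemma quiet_inc r s : quiet (Inc r) s (fun j => if j == r then (s j).+1 else s j).
Proof.
apply: quiet1 => p K h o; rewrite /cstep/= act_stay; congr Conf.
by apply/funext => j; case: eqP.
Qed.

Lemma quiet_dec r s : quiet (Dec r) s (fun j => if j == r then (s j).-1 else s j).
Proof.
apply: quiet1 => p K h o; rewrite /cstep/= act_stay; congr Conf.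
by apply/funext => j; case: eqP.
Qed.

Lemma quiet_seq c1 c2 s1 s2 s3 :
  quiet c1 s1 s2 -> quiet c2 s2 s3 -> quiet (Seq c1 c2) s1 s3.
Proof.
move=> q1 q2 p K h o.
have [n1 r1] := q1 p (c2 :: K) h o; have [n2 r2] := q2 p K h o.
exists (n1.+1 + n2.+1); apply: reach_step; rewrite /cstep/= act_stay//.
exact: reach_trans r1 r2.
Qed.

Lemma quiet_if r c1 c2 s s' :
  quiet (if s r == 0 then c2 else c1) s s' -> quiet (If r c1 c2) s s'.
Proof. by apply: quiet_jump => p K h o; rewrite /cstep/= act_stay. Qed.

Lemma quiet_while0 r c s : s r = 0 -> quiet (While r c) s s.
Proof. by move=> s0; apply: quiet1 => p K h o; rewrite /cstep/= act_stay s0. Qed.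

Lemma quiet_whileS r c s s1 s2 : s r != 0 ->
  quiet c s s1 -> quiet (While r c) s1 s2 -> quiet (While r c) s s2.
Proof.
move=> /negPf s0 q1 q2 p K h o.
have [n1 r1] := q1 p (While r c :: K) h o; have [n2 r2] := q2 p K h o.
exists (n1.+1 + n2.+1); apply: reach_step; rewrite /cstep/= act_stay// s0.
exact: reach_trans r1 r2.
Qed.

(* The registers from d on hold the list L, followed by zeros. *)
Definition stack (d : nat) (b : nat -> nat) (L : seq nat) : nat -> nat :=
  fun j => if j < d then b j else nth 0 L (j - d).

Lemma stackE d b L i : stack d b L (d + i) = nth 0 L i.
Proof. by rewrite /stack ltnNge leq_addr/= addKn. Qed.

(** Lets a program that works from register [d.+1] on run above a saved value, which becomes part of
    the base. *)
Lemma stackS d b x L : stack d b (x :: L) = stack d.+1 (stack d b [:: x]) L.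
Proof.
apply/funext => j; rewrite /stack ltnS; case: (ltngtP j d) => // [dj|->].
  by rewrite -(subnSK dj).
by rewrite subnn.
Qed.

Lemma stack_rcons0 d b L : stack d b (rcons L 0) = stack d b L.
Proof.
apply/funext => j; rewrite /stack nth_rcons; case: ifP => // _.
by case: ltnP => // h; rewrite (nth_default _ h) if_same.
Qed.

Lemma stack_inc d i b L : quiet (Inc (d + i)) (stack d b L)
  (stack d b (set_nth 0 L i (nth 0 L i).+1)).
Proof.
have := quiet_inc (d + i) (stack d b L); congr (quiet _ _).
apply/funext => j; rewrite /stack nth_set_nth/=.
case: ltnP => jd; first by case: eqP => // je; move: jd; rewrite je ltnNge leq_addr.
rewrite -{1}(subnKC jd) eqn_add2l; by case: eqP => // ->.
Qed.

Lemma stack_dec d i b L : quiet (Dec (d + i)) (stack d b L)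
  (stack d b (set_nth 0 L i (nth 0 L i).-1)).
Proof.
have := quiet_dec (d + i) (stack d b L); congr (quiet _ _).
apply/funext => j; rewrite /stack nth_set_nth/=.
case: ltnP => jd; first by case: eqP => // je; move: jd; rewrite je ltnNge leq_addr.
rewrite -{1}(subnKC jd) eqn_add2l; by case: eqP => // ->.
Qed.

Definition Loop r c := While r (Seq (Dec r) c).

Lemma stack_loop0 d i b L c : nth 0 L i = 0 ->
  quiet (Loop (d + i) c) (stack d b L) (stack d b L).
Proof. by move=> L0; apply: quiet_while0; rewrite stackE. Qed.

Lemma stack_loopS d i b L n c s s' : nth 0 L i = n.+1 ->
  quiet c (stack d b (set_nth 0 L i n)) s ->
  quiet (Loop (d + i) c) s s' -> quiet (Loop (d + i) c) (stack d b L) s'.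
Proof.
move=> Ln q; apply: quiet_whileS; first by rewrite stackE Ln.
apply: quiet_seq q; rewrite -[n]/(n.+1.-1) -Ln; exact: stack_dec.
Qed.

(** * Primitive recursion *)

(** Unary functions only: Cantor pairs stand for tuples and pure iteration for the recursion scheme,
    so a single register holds the whole argument. *)
Inductive code :=
  | CZero
  | CSucc
  | CFst
  | CSnd
  | CPair of code & code
  | CComp of code & code
  | CIter of code.

Fixpoint eval (c : code) (x : nat) : nat :=
  match c with
  | CZero => 0
  | CSucc => x.+1
  | CFst => (uncantor x).1
  | CSnd => (uncantor x).2
  | CPair c1 c2 => cantor (eval c1 x) (eval c2 x)
  | CComp c1 c2 => eval c1 (eval c2 x)
  | CIter c => iter (uncantor x).1 (eval c) (uncantor x).2
  end.

(** * Arithmetic on registers *)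

Section Programs.
Variable d : nat.

Definition Clear i := Loop (d + i) Skip.
Definition Move i j := Loop (d + i) (Inc (d + j)).
(** Inverts the pairing by counting: the loop body is [uncantor_next] on registers 1 and 2. *)
Definition Unpair :=
  Loop (d + 0) (If (d + 1) (Seq (Dec (d + 1)) (Inc (d + 2)))
                           (Seq (Move 2 1) (Inc (d + 1)))).
(* Computes [cantor n k] as k plus the sum of the numbers up to n + k. *)
Definition PairUp :=
  Seq (Loop (d + 0) (Seq (Inc (d + 2)) (Inc (d + 3))))
  (Seq (Move 1 2)
  (Seq (Move 3 0)
  (Loop (d + 2) (Seq (Inc (d + 0))
    (Seq (Loop (d + 2) (Seq (Inc (d + 0)) (Inc (d + 1)))) (Move 1 2)))))).
(* Register i is copied to register j by means of register k. *)
Definition Copy i j k :=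
  Seq (Loop (d + i) (Seq (Inc (d + j)) (Inc (d + k)))) (Move k i).

Variable b : nat -> nat.
Local Notation st := (stack d b).

Lemma nth_set0 (s : seq nat) i a j :
  nth 0 (set_nth 0 s i a) j = if j == i then a else nth 0 s j.
Proof. by rewrite nth_set_nth. Qed.

Lemma clear_quiet i L : quiet (Clear i) (st L) (st (set_nth 0 L i 0)).
Proof.
have [n Ln] : exists n, nth 0 L i = n by exists (nth 0 L i).
elim: n L Ln => [|n IH] L Ln.
  have -> : st (set_nth 0 L i 0) = st L.
    apply/funext => j; rewrite /stack nth_set_nth/=.
    by case: ifP => // _; case: eqP => // ->.
  exact: stack_loop0.
apply: (stack_loopS Ln); first exact: quiet_skip.
have := IH (set_nth 0 L i n); rewrite nth_set_nth/= eqxx => /(_ erefl).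
by rewrite set_set_nth eqxx.
Qed.

Lemma set_nthK (L : seq nat) i : i < size L -> set_nth 0 L i (nth 0 L i) = L.
Proof.
elim: L i => [//|a L IH] [|i]//=; rewrite ltnS => iL.
by rewrite IH.
Qed.

Lemma move_quiet i j L : i < size L -> j < size L -> i != j ->
  quiet (Move i j) (st L)
    (st (set_nth 0 (set_nth 0 L i 0) j (nth 0 L i + nth 0 L j))).
Proof.
move=> iL jL ij.
have [n Ln] : exists n, nth 0 L i = n by exists (nth 0 L i).
elim: n L Ln iL jL => [|n IH] L Ln iL jL.
  have L0 := set_nthK iL; rewrite Ln in L0.
  by rewrite Ln L0 add0n set_nthK//; exact: stack_loop0.
apply: (stack_loopS Ln); first exact: stack_inc.
set L1 := set_nth 0 (set_nth _ _ _ _) _ _.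
have sz : size L1 = size L by rewrite !size_set_nth; lia.
have L1E l : nth 0 L1 l = if l == j then (nth 0 L j).+1
    else if l == i then n else nth 0 L l.
  by rewrite !nth_set0 ![j == _]eq_sym (negPf ij).
clearbody L1.
have := IH L1; rewrite sz L1E (negPf ij) eqxx => /(_ erefl iL jL).
congr (quiet _ _ (st _)).
apply: (@eq_from_nth _ 0) => [|l _]; first by rewrite !size_set_nth sz.
rewrite !nth_set0 !L1E eqxx Ln addSnnS.
by case: eqP => //; case: eqP.
Qed.

Lemma copy_quiet i j k L : i < size L -> j < size L -> k < size L ->
  i != j -> j != k -> i != k -> nth 0 L k = 0 ->
  quiet (Copy i j k) (st L) (st (set_nth 0 L j (nth 0 L i + nth 0 L j))).
Proof.
move=> iL jL kL ij jk ik Lk.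
have dup : quiet (Loop (d + i) (Seq (Inc (d + j)) (Inc (d + k)))) (st L)
  (st (set_nth 0 (set_nth 0 (set_nth 0 L i 0) j (nth 0 L i + nth 0 L j)) k
        (nth 0 L i + nth 0 L k))).
  clear Lk; have [n Ln] : exists n, nth 0 L i = n by exists (nth 0 L i).
  elim: n L Ln iL jL kL => [|n IH] L Ln iL jL kL.
    have L0 := set_nthK iL; rewrite Ln in L0.
    by rewrite Ln L0 !add0n !set_nthK//; exact: stack_loop0.
  apply: (stack_loopS Ln); first by apply: quiet_seq; exact: stack_inc.
  set L1 := set_nth 0 (set_nth _ (set_nth _ _ _ _) _ _) _ _.
  have sz : size L1 = size L by rewrite !size_set_nth; lia.
  have L1E l : nth 0 L1 l = if l == k then (nth 0 L k).+1
    else if l == j then (nth 0 L j).+1 else if l == i then n else nth 0 L l.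
    rewrite !nth_set0.
    by rewrite ![k == _]eq_sym (negPf jk) (negPf ik) ![j == _]eq_sym (negPf ij).
  have L1i : nth 0 L1 i = n by rewrite L1E (negPf ik) (negPf ij) eqxx.
  clearbody L1.
  have := IH L1 L1i; rewrite sz => /(_ iL jL kL); congr (quiet _ _ (st _)).
  apply: (@eq_from_nth _ 0) => [|l]; first by rewrite !size_set_nth sz//; lia.
  move=> _; rewrite !nth_set0 !L1E !eqxx.
  rewrite (negPf ik) (negPf ij) (negPf jk) Ln !addSnnS.
  by case: eqP => //; case: eqP => //; case: eqP.
apply: quiet_seq dup _; set L1 := set_nth 0 (set_nth _ (set_nth _ _ _ _) _ _) _ _.
have sz : size L1 = size L by rewrite !size_set_nth; lia.
have L1E l : nth 0 L1 l = if l == k then nth 0 L i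
  else if l == j then nth 0 L i + nth 0 L j else if l == i then 0 else nth 0 L l.
  by rewrite !nth_set0 Lk addn0.
clearbody L1.
have := @move_quiet k i L1; rewrite sz eq_sym => /(_ kL iL ik).
congr (quiet _ _ (st _)).
apply: (@eq_from_nth _ 0) => [|l]; first by rewrite !size_set_nth sz//; lia.
move=> _; rewrite !nth_set0 !L1E !eqxx.
rewrite (negPf ik) (negPf ij) addn0.
case: (l =P i) => [->|_]; first by rewrite (negPf ij).
case: (l =P k) => [->|//]; by rewrite eq_sym (negPf jk) Lk.
Qed.

Lemma unpair_quiet x :
  quiet Unpair (st [:: x]) (st [:: 0; (uncantor x).1; (uncantor x).2]).
Proof.
have -> : st [:: x] = st [:: x; 0; 0].
  by rewrite -[[:: x; 0; 0]]/(rcons [:: x; 0] 0) stack_rcons0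
             -[[:: x; 0]]/(rcons [:: x] 0) stack_rcons0.
rewrite /uncantor -[0 in X in quiet _ (_ X)]/((0, 0).1).
rewrite -[[:: x; _; _]]/[:: x; (0, 0).1; (0, 0).2].
move: (0, 0) => u; elim: x u => [|x IH] u; first exact: stack_loop0.
apply: (stack_loopS (n := x)) => //; last by rewrite iterSr; exact: IH.
case: u => [[|n] k]; apply: quiet_if; rewrite stackE/=.
  have := @move_quiet 2 1 [:: x; 0; k] isT isT isT; rewrite /= addn0 => q.
  by apply: quiet_seq q _; exact: stack_inc.
exact: quiet_seq (stack_dec _ _ _ _) (stack_inc _ _ _ _).
Qed.

Lemma cantorE n k : cantor n k = k + \sum_(i < n + k) i.+1.
Proof.
rewrite /cantor addnC; congr (_ + _); elim: (n + k) => [|s IH];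
  first by rewrite big_ord0.
rewrite big_ord_recr -IH.
have -> : s.+1 * s.+2 = s.+1.*2 + s * s.+1 by nia.
by rewrite halfD odd_double add0n doubleK addnC.
Qed.

(** The second component lies below the first. This suits the driver, where the code of the list
    read so far is below the new symbol. *)
Lemma pairup_quiet n k :
  quiet PairUp (st [:: k; n]) (st [:: cantor n k]).
Proof.
have -> : st [:: k; n] = st [:: k; n; 0; 0].
  by rewrite -[[:: k; n; 0; 0]]/(rcons [:: k; n; 0] 0) stack_rcons0
             -[[:: k; n; 0]]/(rcons [:: k; n] 0) stack_rcons0.
have -> m : st [:: m] = st [:: m; 0; 0; 0].
  by rewrite -[[:: m; 0; 0; 0]]/(rcons [:: m; 0; 0] 0) stack_rcons0
     -[[:: m; 0; 0]]/(rcons [:: m; 0] 0) stack_rcons0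
     -[[:: m; 0]]/(rcons [:: m] 0) stack_rcons0.
have add m u v w : quiet (Loop (d + 2) (Seq (Inc (d + 0)) (Inc (d + 1))))
    (st [:: u; v; m; w]) (st [:: u + m; v + m; 0; w]).
  elim: m u v => [|m IH] u v; first by rewrite !addn0; exact: stack_loop0.
  apply: (stack_loopS (n := m)) => //; first by apply: quiet_seq; exact: stack_inc.
  by rewrite -![_ + m.+1]addSnnS; exact: IH.
have sum m u : quiet (Loop (d + 2) (Seq (Inc (d + 0))
    (Seq (Loop (d + 2) (Seq (Inc (d + 0)) (Inc (d + 1)))) (Move 1 2))))
    (st [:: u; 0; m; 0]) (st [:: u + \sum_(i < m) i.+1; 0; 0; 0]).
  elim: m u => [|m IH] u; first by rewrite big_ord0 (addn0 u); exact: stack_loop0.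
  apply: (stack_loopS (n := m)) => //=.
    apply: quiet_seq (stack_inc _ _ _ _) _; apply: quiet_seq; first exact: add.
    exact: (@move_quiet 1 2 [:: _; _; _; _]).
  rewrite /= add0n (addn0 m) big_ord_recr/=.
  have -> : u + (\sum_(i < m) i.+1 + m.+1) = u.+1 + m + \sum_(i < m) i.+1 by lia.
  exact: IH.
have dup m u v w : quiet (Loop (d + 0) (Seq (Inc (d + 2)) (Inc (d + 3))))
    (st [:: m; u; v; w]) (st [:: 0; u; v + m; w + m]).
  elim: m v w => [|m IH] v w; first by rewrite (addn0 v) (addn0 w); exact: stack_loop0.
  apply: (stack_loopS (n := m)) => //; first by apply: quiet_seq; exact: stack_inc.
  by rewrite -![_ + m.+1]addSnnS; exact: IH.
apply: quiet_seq (dup _ _ _ _) _; rewrite cantorE.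
apply: quiet_seq; first exact: (@move_quiet 1 2 [:: _; _; _; _]).
apply: quiet_seq; first exact: (@move_quiet 3 0 [:: _; _; _; _]).
rewrite /= (addn0 k) !add0n. exact: sum.
Qed.

End Programs.

Fixpoint compile (d : nat) (c : code) : cmd :=
  match c with
  | CZero => Clear d 0
  | CSucc => Inc (d + 0)
  | CFst => Seq (Unpair d) (Seq (Clear d 2) (Move d 1 0))
  | CSnd => Seq (Unpair d) (Seq (Clear d 1) (Move d 2 0))
  | CPair c1 c2 =>
      Seq (Copy d 0 1 2) (Seq (compile d.+1 c2) (Seq (Copy d 0 2 3)
      (Seq (Clear d 0) (Seq (Move d 1 0) (Seq (Move d 2 1)
      (Seq (compile d.+1 c1) (PairUp d)))))))
  | CComp c1 c2 => Seq (compile d c2) (compile d c1)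
  | CIter c =>
      Seq (Unpair d) (Seq (Move d 1 0) (Seq (Move d 2 1)
      (Seq (Loop (d + 0) (compile d.+1 c)) (Move d 1 0))))
  end.

(** Scratch registers come and go by this lemma, as zeros at the end of the list are invisible. *)
Lemma stack_pad d b L m : stack d b (L ++ nseq m 0) = stack d b L.
Proof.
elim: m => [|m IH]; first by rewrite cats0.
by rewrite -addn1 nseqD catA cats1 stack_rcons0.
Qed.

Lemma compile_quiet c d b x :
  quiet (compile d c) (stack d b [:: x]) (stack d b [:: eval c x]).
Proof.
elim: c d b x => [||||c1 IH1 c2 IH2|c1 IH1 c2 IH2|c IH] d b x /=.
- exact: clear_quiet.
- exact: stack_inc.
- apply: quiet_seq; first exact: unpair_quiet.
  apply: quiet_seq; first exact: clear_quiet.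
  rewrite -(stack_pad _ _ [:: (uncantor x).1] 2) -[in X in quiet _ _ X](addn0 (_.1)).
  exact: (@move_quiet d b 1 0 [:: _; _; _]).
- apply: quiet_seq; first exact: unpair_quiet.
  apply: quiet_seq; first exact: clear_quiet.
  rewrite -(stack_pad _ _ [:: (uncantor x).2] 2) -[in X in quiet _ _ X](addn0 (_.2)).
  exact: (@move_quiet d b 2 0 [:: _; _; _]).
(* With [y] and [z] the values of [c2] and [c1] at [x], the registers from [d] on pass through
   [[x; x]], [[x; y]], [[x; y; x]], [[y; x]], [[y; z]]. *)
- rewrite -(stack_pad _ _ [:: x] 3); apply: quiet_seq.
    exact: (@copy_quiet d b 0 1 2 [:: _; _; _; _]).
  rewrite /= addn0 (stack_pad d b [:: x; x] 2) stackS; apply: quiet_seq;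
    first exact: IH2.
  rewrite -stackS -(stack_pad _ _ [:: x; _] 2); apply: quiet_seq.
    exact: (@copy_quiet d b 0 2 3 [:: _; _; _; _]).
  apply: quiet_seq; first exact: clear_quiet.
  apply: quiet_seq; first exact: (@move_quiet d b 1 0 [:: _; _; _; _]).
  apply: quiet_seq; first exact: (@move_quiet d b 2 1 [:: _; _; _; _]).
  rewrite /= !addn0 (stack_pad d b [:: _; x] 2) stackS.
  apply: quiet_seq; first exact: IH1.
  rewrite -stackS; exact: pairup_quiet.
- exact: quiet_seq (IH2 _ _ _) (IH1 _ _ _).
- apply: quiet_seq; first exact: unpair_quiet.
  case: (uncantor x) => n y /=.
  apply: quiet_seq; first exact: (@move_quiet d b 1 0 [:: _; _; _]).
  apply: quiet_seq; first exact: (@move_quiet d b 2 1 [:: _; _; _]).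
  rewrite /= (addn0 n) (addn0 y) (stack_pad d b [:: n; y] 1).
  have := (@move_quiet d b 1 0 [:: 0; iter n (eval c) y] isT isT isT).
  rewrite /= addn0 (stack_pad d b [:: iter n (eval c) y] 1); apply: quiet_seq.
  elim: n y => [|n IHn] y; first exact: stack_loop0.
  apply: (stack_loopS (n := n)) => //=; last by rewrite -iterS iterSr; exact: IHn.
  rewrite (stackS d b n [:: y]) (stackS d b n [:: eval c y]); exact: IH.
Qed.

Class encodable (T : Type) := enc : T -> nat.

Instance encodable_nat : encodable nat := id.
Instance encodable_bool : encodable bool := nat_of_bool.
Instance encodable_prod A B {eA : encodable A} {eB : encodable B} :
  encodable (A * B) := fun x => cantor (enc x.1) (enc x.2).
Instance encodable_seq A {eA : encodable A} : encodable (seq A) :=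
  foldr (fun a n => (cantor (enc a) n).+1) 0.

Definition primrec A B {eA : encodable A} {eB : encodable B} (f : A -> B) : Prop :=
  exists c, forall a, eval c (enc a) = enc (f a).

(** * The driver *)

(** The latest cell comes first, so that reading a cell is a cons. The list includes the blank cell
    0, which shifts the word by one. *)
Fixpoint prefix (p : baire) (t : nat) : seq nat :=
  if t is t'.+1 then in_cell p t' :: prefix p t' else [::].

Lemma in_cell_le2 p h : in_cell p h <= 2.
Proof. by case: h => //= h; rewrite /word; case: ifP. Qed.

(* A one-way machine must not move its head to the left. *)
Definition emit (one_way : bool) (v : nat) (T : tape) : tape :=
  match v with
  | 1 => act (Some one) Right T
  | 2 => act (Some sep) Right T
  | 3 => if one_way then T else act None Left T
  | _ => T
  end.

Section Driver.
Variables (ow : bool) (c : code).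

(** A value from 4 on lowers the flag in register 1 and so ends the loop of the driver; this is how
    halting is programmed. *)
Definition dispatch : cmd :=
  If 3 (Seq (Dec 3) (If 3 (Seq (Dec 3) (If 3 (Seq (Dec 3)
    (If 3 (Seq (Clear 0 3) (Dec 1)) (if ow then Skip else Back)))
    (Put sep))) (Put one))) Skip.

(* Register 0 holds the parameter, register 1 the flag that keeps the loop
   going, register 2 the code of the input read so far. *)
Definition read : cmd := Get Skip (Inc 3) (Seq (Inc 3) (Inc 3)).

(** [PairUp] followed by [Inc] is the code of a cons, so register 2 keeps the code of the growing
    prefix. The copies serve to form the code of the pair of parameter and prefix in register 3. *)
Definition evaluate : cmd :=
  Seq (PairUp 2) (Seq (Inc 2) (Seq (Copy 0 2 3 5) (Seq (Copy 0 0 4 5)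
  (Seq (PairUp 3) (compile 3 c))))).

Definition stage : cmd := Seq read (Seq evaluate dispatch).

Definition driver : cmd := While 1 stage.

Variable b : nat -> nat.
Local Notation st := (stack 0 b).

Lemma stack_inc0 i L : quiet (Inc i) (st L) (st (set_nth 0 L i (nth 0 L i).+1)).
Proof. exact: (stack_inc 0 i). Qed.

Lemma stack_dec0 i L : quiet (Dec i) (st L) (st (set_nth 0 L i (nth 0 L i).-1)).
Proof. exact: (stack_dec 0 i). Qed.

Lemma quiet_reach p cm s s' K h o : quiet cm s s' ->
  exists n, reach p n (Conf (cm :: K) s h o) (Conf K s' h o).
Proof. by move=> /(_ p K h o)[n r]; exists n.+1. Qed.

Lemma dispatch_reach p K h o N X v : exists n,
  reach p n (Conf (dispatch :: K) (st [:: N; 1; X; v]) h o)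
    (Conf K (st [:: N; (v < 4 : nat); X; 0]) h (emit ow v o)).
Proof.
have go cm s C : (exists n, reach p n (cstep p (Conf (cm :: K) s h o)) C) ->
    outp (cstep p (Conf (cm :: K) s h o)) = o ->
    exists n, reach p n (Conf (cm :: K) s h o) C.
  by move=> [n r] E; exists n.+1; apply: reach_step.
have dec c' u C : (exists n, reach p n (Conf (c' :: K) (st [:: N; 1; X; u]) h o) C) ->
    exists n, reach p n (Conf (Seq (Dec 3) c' :: K) (st [:: N; 1; X; u.+1]) h o) C.
  move=> [n r]; have [m r'] := stack_dec0 3 [:: N; 1; X; u.+1] p (c' :: K) h o.
  exists (m.+1 + n).+1; apply: reach_step; rewrite /cstep/= act_stay//.
  exact: reach_trans r' r.
have one a s o' : cstep p (Conf (a :: K) s h o) = Conf K s h o' ->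
    exists n, reach p n (Conf (a :: K) s h o) (Conf K s h o').
  by move=> E; exists 1; split=> // -[].
rewrite /dispatch; apply: (go); rewrite /cstep/= act_stay//; case: v => [|v].
  by apply: (one); rewrite /cstep/= act_stay.
apply: (dec); apply: (go); rewrite /cstep/= act_stay//; case: v => [|v].
  by apply: (one).
apply: (dec); apply: (go); rewrite /cstep/= act_stay//; case: v => [|v].
  by apply: (one).
apply: (dec); apply: (go); rewrite /cstep/= act_stay//; case: v => [|v].
  by apply: (one); case: ow; rewrite /cstep//= act_stay.
apply: quiet_reach; apply: quiet_seq; first exact: (clear_quiet 0 b 3).
exact: stack_dec0.
Qed.

Lemma stage_reach p K h o N X :
  let X' := (cantor (in_cell p h) X).+1 in let v := eval c (cantor N X') in
  exists n, reach p n (Conf (stage :: K) (st [:: N; 1; X]) h o)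
    (Conf K (st [:: N; (v < 4 : nat); X']) h.+1 (emit ow v o)).
Proof.
move=> X' v.
rewrite -(stack_pad _ _ [:: N; 1; X] 1) -(stack_pad _ _ [:: N; (v < 4 : nat); X'] 1).
pose a := in_cell p h.
have [n1 r1] : exists n, reach p n (Conf (stage :: K) (st [:: N; 1; X; 0]) h o)
    (Conf (Seq evaluate dispatch :: K) (st [:: N; 1; X; a]) h.+1 o).
  have [n r] : exists n, reach p n
      (Conf (next (read :: Seq evaluate dispatch :: K) xpred0 a)
         (st [:: N; 1; X; 0]) h.+1 o)
      (Conf (Seq evaluate dispatch :: K) (st [:: N; 1; X; a]) h.+1 o).
    apply: quiet_reach; have := in_cell_le2 p h; rewrite -/a.
    case: (a) => [|[|[|//]]] _; first exact: quiet_skip.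
      exact: stack_inc0.
    apply: quiet_seq; exact: stack_inc0.
  exists n.+2; do 2 (apply: reach_step; rewrite /cstep/= ?act_stay//).
have [n2 r2] : exists n, reach p n
    (Conf (Seq evaluate dispatch :: K) (st [:: N; 1; X; a]) h.+1 o)
    (Conf (dispatch :: K) (st [:: N; 1; X'; v]) h.+1 o).
  have q : quiet evaluate (st [:: N; 1; X; a]) (st [:: N; 1; X'; v]).
    apply: quiet_seq.
      rewrite (stackS 0 b N) (stackS 1 _ 1); exact: pairup_quiet.
    rewrite -(stackS 1 _ 1) -(stackS 0 b N).
    apply: quiet_seq; first exact: stack_inc0.
    rewrite /= -/X' -(stack_pad _ _ _ 3).
    apply: quiet_seq; first exact: (@copy_quiet 0 b 2 3 5 [:: _; _; _; _; _; _]).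
    apply: quiet_seq; first exact: (@copy_quiet 0 b 0 4 5 [:: _; _; _; _; _; _]).
    rewrite /= (addn0 X') (addn0 N) (stack_pad 0 b [:: N; 1; X'; X'; N] 1).
    rewrite (stackS 0 b N) (stackS 1 _ 1) (stackS 2 _ X').
    apply: quiet_seq; first exact: pairup_quiet.
    rewrite (stackS 0 b N [:: 1; X'; v]) (stackS 1 _ 1 [:: X';
      v]) (stackS 2 _ X' [:: v]).
    exact: compile_quiet.
  have [n r] := quiet_reach p (dispatch :: K) h.+1 o q.
  by exists n.+1; apply: reach_step; rewrite /cstep/= act_stay.
have [n3 r3] := dispatch_reach p K h.+1 o N X' v.
exists (n1 + (n2 + n3)); apply: reach_trans r1 _ => //.
exact: reach_trans r2 r3.
Qed.
End Driver.

(** * From counter programs to machines *)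

(** The control states that can occur between [c :: K] and [K]. They form a finite list, although
    control states are arbitrary lists of commands; this makes a finite table possible. *)
Fixpoint conts (c : cmd) (K : seq cmd) : seq (seq cmd) :=
  (c :: K) :: match c with
  | Seq a b => conts a (b :: K) ++ conts b K
  | If _ a b => conts a K ++ conts b K
  | While _ a => conts a (c :: K)
  | Get a0 a1 a2 => conts a0 K ++ conts a1 K ++ conts a2 K
  | _ => [::]
  end.

Lemma mem_conts c K : c :: K \in conts c K.
Proof. by case: c => *; exact: mem_head. Qed.

Lemma conts_next c K K1 z a : K1 \in conts c K ->
  K1 != [::] /\ next K1 z a \in K :: conts c K.
Proof.
elim: c K => [|r|r|s||c1 IH1 c2 IH2|r c1 IH1 c2 IH2|r c1 IH1|c1 IH1 c2 IH2 c3 IH3] K /=;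
  rewrite in_cons => /orP[/eqP-> /=|]; rewrite ?inE ?mem_cat ?eqxx ?mem_conts ?orbT //.
- by case/orP => [/IH1|/IH2] [-> +]; rewrite !inE => /orP[/eqP->|->];
  rewrite ?mem_conts ?eqxx ?orbT.
- by split=> //; case: (z r); rewrite mem_conts ?orbT.
- by case/orP => [/IH1|/IH2] [-> +]; rewrite !inE => /orP[->|->]; rewrite ?orbT.
- by split=> //; case: (z r); rewrite ?eqxx ?mem_conts ?orbT.
- by move=> /IH1[-> +]; rewrite !inE => /orP[->|->]; rewrite ?orbT.
- by split=> //; case: (a) => [|[|?]]; rewrite mem_conts ?orbT.
- by case/or3P => [/IH1|/IH2|/IH3] [-> +]; rewrite !inE => /orP[->|->]; rewrite ?orbT.
Qed.

Fixpoint fits (ow : bool) (k : nat) (c : cmd) : bool :=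
  match c with
  | Skip | Put _ => true
  | Inc r | Dec r => r < k
  | Back => ~~ ow
  | Seq a b => fits ow k a && fits ow k b
  | If r a b => [&& r < k, fits ow k a & fits ow k b]
  | While r a => (r < k) && fits ow k a
  | Get a0 a1 a2 => [&& fits ow k a0, fits ow k a1 & fits ow k a2]
  end.

Lemma fits_conts ow k c K K1 : fits ow k c -> all (fits ow k) K ->
  K1 \in conts c K -> all (fits ow k) K1.
Proof.
elim: c K => [|r|r|s||c1 IH1 c2 IH2|r c1 IH1 c2 IH2|r c1 IH1|c1 IH1 c2 IH2 c3 IH3] K /=
  fc fK; rewrite in_cons => /orP[/eqP-> /=|]; rewrite ?fc// ?mem_cat.
- by case/andP: fc => f1 f2 /orP[/IH1|/IH2]; apply=> //=; rewrite f2.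
- by case/and3P: fc => _ f1 f2 /orP[/IH1|/IH2]; apply.
- by case/andP: (fc) => _ f1 /IH1; apply=> //=; rewrite fc.
- by case/and3P: fc => f1 f2 f3 /or3P[/IH1|/IH2|/IH3]; apply.
Qed.

Lemma fits_leq ow k k' c : k <= k' -> fits ow k c -> fits ow k' c.
Proof.
move=> kk'; elim: c => //=.
- by move=> r rk; exact: leq_trans rk kk'.
- by move=> r rk; exact: leq_trans rk kk'.
- by move=> a IHa b IHb /andP[/IHa-> /IHb->].
- by move=> r a IHa b IHb /and3P[rk /IHa-> /IHb->]; rewrite (leq_trans rk kk').
- by move=> r a IHa /andP[rk /IHa->]; rewrite (leq_trans rk kk').
- by move=> a IHa b IHb c IHc /and3P[/IHa-> /IHb-> /IHc->].
Qed.

Lemma fits_weaken ow k c : fits true k c -> fits ow k c.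
Proof.
elim: c => //=.
- by move=> a IHa b IHb /andP[/IHa-> /IHb->].
- by move=> r a IHa b IHb /and3P[-> /IHa-> /IHb->].
- by move=> r a IHa /andP[-> /IHa->].
- by move=> a IHa b IHb c IHc /and3P[/IHa-> /IHb-> /IHc->].
Qed.

Lemma compile_fits c d : exists2 k, d + 4 <= k & fits true k (compile d c).
Proof.
elim: c d => [||||c1 IH1 c2 IH2|c1 IH1 c2 IH2|c IH] d.
1-4: by exists (d + 4) => //=; repeat (apply/andP; split); lia.
- have [k1 dk1 f1] := IH1 d.+1; have [k2 dk2 f2] := IH2 d.+1.
  have {}f1 := fits_leq (leq_maxl k1 k2) f1; have {}f2 := fits_leq (leq_maxr k1 k2) f2.
  by exists (maxn k1 k2) => /=; rewrite ?f1 ?f2 /=; repeat (apply/andP;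
    split) => //; lia.
- have [k1 dk1 f1] := IH1 d; have [k2 dk2 f2] := IH2 d.
  have {}f1 := fits_leq (leq_maxl k1 k2) f1; have {}f2 := fits_leq (leq_maxr k1 k2) f2.
  by exists (maxn k1 k2); rewrite /= ?f1 ?f2 ?leq_max ?dk1.
- have [k dk fk] := IH d.+1.
  by exists k; rewrite /= ?fk /=; repeat (apply/andP; split) => //; lia.
Qed.

Lemma driver_fits ow c : exists k, fits ow k.+1 (Seq (Inc 1) (driver ow c)).
Proof.
have [k dk fk] := compile_fits c 3; exists k.
have {}fk := fits_weaken ow (fits_leq (leqnSn k) fk).
rewrite /= fk; have -> : fits ow k.+1 (if ow then Skip else Back) by case: ow {fk}.
by rewrite /=; repeat (apply/andP; split) => //; lia.
Qed.

HB.instance Definition _ k := gen_eqMixin (rule k).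

(** Applicable rules of the assembled tables coincide, so the order of the rules never has to be
    considered. *)
Lemma step_rule k (rs : seq (rule k)) p (C : config k) r : r \in rs ->
  applicable p C r -> (forall r', r' \in rs -> applicable p C r' -> r' = r) ->
  step (M := Machine rs) p C = Some (execute C r).
Proof.
move=> rrs ar uniq_r; rewrite /step/=.
have : r \in [seq r' <- rs | applicable p C r'] by rewrite mem_filter ar.
case E : [seq _ <- _ | _] => [|r' s]// _ /=.
have : r' \in [seq r' <- rs | applicable p C r'] by rewrite E mem_head.
by rewrite mem_filter => /andP[ar' r'rs]; rewrite (uniq_r r').
Qed.

(** * The table of a counter program with a built-in parameter *)

Section Assembly.
Variables (ow : bool) (k' : nat) (c0 : cmd).
Let k := k'.+1.
Hypothesis c0_fits : fits ow k c0.

Definition controls : seq (seq cmd) := [::] :: conts c0 [::].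
(** State 0 is reserved for the start; the states of the chain come after all labels. *)
Definition label (K : seq cmd) : nat := (index K controls).+1.
Definition chain_base : nat := (size controls).+1.

(* z j tells whether the head on work tape j is on cell 0, the only marked one. *)
Definition main_rule (x : seq cmd * {ffun 'I_k -> bool}) (a : nat) : rule k :=
  let: (K, z) := x in
  Rule (label K) a [ffun j => z j : nat]
    (label (next K (fun r => [exists j : 'I_k, (j == r :> nat) && z j]) a))
    (inp_move K) [ffun j => z j : nat] [ffun j : 'I_k => reg_move K j]
    (out_write K) (out_move K).

Definition main_rules : seq (rule k) :=
  [seq main_rule x a |
     x <- [seq (K, z) | K <- conts c0 [::], z <- enum {ffun 'I_k -> bool}],
     a <- iota 0 3].

Definition first_move (m : move) : {ffun 'I_k -> move} :=
  [ffun j => if j == ord0 then m else Stay].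
Definition chain_read : {ffun 'I_k -> nat} := [ffun j => j != ord0 : nat].

(* The parameter n is stored in the first transition, which enters a descending
   chain of states that increments counter 0. *)
Definition start_rule (n : nat) : rule k :=
  Rule 0 0 [ffun=> 0] (chain_base + n) Stay [ffun=> 1] (first_move Right) None Stay.
Definition chain_rule (m : nat) : rule k :=
  Rule (chain_base + m.+1) 0 chain_read (chain_base + m) Stay chain_read
    (first_move Right) None Stay.
(** Takes back the step to the right that [start_rule] makes. This extra step keeps head 0 off its
    marked cell, so that every state of the chain reads the same symbols. *)
Definition enter_rule : rule k :=
  Rule chain_base 0 chain_read (label [:: c0]) Stay chain_read
    (first_move Left) None Stay.

Definition assemble (n : nat) : seq (rule k) :=
  start_rule n :: [seq chain_rule m | m <- rev (iota 0 n)] ++ enter_rule :: main_rules.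

Lemma main_ruleP r : reflect (exists K z a, [/\ K \in conts c0 [::], a < 3
  & r = main_rule (K, z) a]) (r \in main_rules).
Proof.
apply: (iffP allpairsP) => [[[x a] [/= /allpairsP[[K z]]]]|[K [z [a [Kc a3 ->]]]]].
  move=> [/= Kc _ ->] a3 ->; exists K, z, a; split=> //.
  by case: a a3 => [|[|[|]]].
exists ((K, z), a); split=> //=; last by case: a a3 => [|[|[|]]].
by apply/allpairsP; exists (K, z); rewrite mem_enum.
Qed.

Lemma assembleP n r : r \in assemble n -> [\/ r = start_rule n,
  exists2 m, m < n & r = chain_rule m, r = enter_rule |
  exists K z a, [/\ K \in conts c0 [::], a < 3 & r = main_rule (K, z) a]].
Proof.
rewrite inE mem_cat inE => /or4P[/eqP->|/mapP[m]|/eqP->|/main_ruleP];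
  last by constructor 4.
- by constructor 1.
- by rewrite mem_rev mem_iota => mn ->; constructor 2; exists m.
- by constructor 3.
Qed.

Lemma label_le K : K \in controls -> label K < chain_base.
Proof. by rewrite ltnS index_mem. Qed.

Lemma label_inj K K' : K \in controls -> K' \in controls ->
  label K = label K' -> K = K'.
Proof.
by move=> Kc K'c /succn_inj E;
  rewrite -[LHS](nth_index [::] Kc) -[RHS](nth_index [::] K'c) E.
Qed.

Lemma next_controls K z a : K \in controls -> next K z a \in controls.
Proof.
by rewrite {1}in_cons => /orP[/eqP->//|/(conts_next z a)[]].
Qed.

Lemma one_way_assemble n : ow -> one_way (Machine (assemble n)).
Proof.
move=> owT; apply/allP => r /assembleP[->|[m _ ->]|->|[K [z [a [Kc _ ->]]]]]//=.
have := fits_conts c0_fits (isT : all _ [::]) Kc.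
by case: K Kc => [//|[]]//=; rewrite owT.
Qed.

Definition tracks (C : conf) (D : config k) : Prop :=
  [/\ state D = label (prog C), in_head D = inp C, out D = outp C &
   forall j, pos (work D j) = regs C j /\ forall c, cell (work D j) c = (c == 0)].

Lemma tracks_halt n p C D : tracks C D -> prog C = [::] ->
  step (M := Machine (assemble n)) p D = None.
Proof.
move=> [sD _ _ _] C0.
suff /eqP E : [seq r <- assemble n | applicable p D r] == [::] 
  by rewrite /step (E : [seq r <- rules (Machine (assemble n)) | applicable p D r] = _).
rewrite -[_ == _]negbK -has_filter; apply/hasP => -[r].
move=> /assembleP rP /and3P[/eqP]; rewrite sD C0 /label/= => + _ _.
case: rP => [->|[m _ ->]|->|[K [z [a [Kc _ ->]]]]]//=.
have [K0 _] := conts_next xpred0 0 Kc.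
by rewrite /label/= eq_sym (negPf K0).
Qed.

Lemma tracks_step n p C D : tracks C D -> prog C \in conts c0 [::] ->
  exists2 D', step (M := Machine (assemble n)) p D = Some D' &
    tracks (cstep p C) D'.
Proof.
move=> [sD hD oD wD] Cc.
have Cctl : prog C \in controls by rewrite inE Cc orbT.
pose z := [ffun j : 'I_k => regs C j == 0].
pose a := in_cell p (inp C).
have a3 : a < 3 by rewrite ltnS in_cell_le2.
have scanE j : scan (work D j) = z j :> nat.
  by have [pj cj] := wD j; rewrite /scan pj cj ffunE.
(* The table can test only the [k] work tapes; since [c0] fits, no other register is ever tested. *)
have zE : next (prog C) (fun r => [exists j : 'I_k, (j == r :> nat) && z j]) a
        = next (prog C) (fun r => regs C r == 0) a.
  have zr r : r < k -> [exists j : 'I_k, (j == r :> nat) && z j] = (regs C r == 0).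
    move=> rk; apply/existsP/idP => [[j /andP[/eqP <-]]|r0]; first by rewrite ffunE.
    by exists (Ordinal rk); rewrite ffunE/= eqxx.
  have := fits_conts c0_fits (isT : all _ [::]) Cc.
  case: (prog C) => [//|[]]//= r.
  - by move=> c1 c2 l /andP[/and3P[rk _ _] _]; rewrite zr.
  - by move=> c1 l /andP[/andP[rk _] _]; rewrite zr.
rewrite (@step_rule _ _ _ _ (main_rule (prog C, z) a)).
- eexists; first by [].
  split=> //=; rewrite ?zE ?hD ?oD//.
  move=> j; have [pj cj] := wD j; rewrite !ffunE; split; first by rewrite pj.
  by move=> c; rewrite cj pj; case: eqP => // ->.
- rewrite inE mem_cat inE; apply/or4P; constructor 4; apply/main_ruleP.
  by exists (prog C), z, a.
- apply/and3P; split; rewrite /= ?sD ?hD ?eqxx//.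
  by apply/forallP => j; rewrite ffunE scanE.
- move=> r /assembleP rP /and3P[/eqP sr /eqP ar /forallP zr].
  have ls := label_le Cctl.
  case: rP sr ar zr => [->|[m _ ->]|->|[K [z' [a' [Kc _ ->]]]]]/=; rewrite sD.
  + by [].
  + by move=> E; move: ls; rewrite -E; lia.
  + by move=> E; move: ls; rewrite -E; lia.
  + move=> /label_inj ->//; last by rewrite inE Kc orbT.
    rewrite hD => -> zr; congr (main_rule (_, _) _); apply/ffunP => j.
    by have := zr j; rewrite ffunE scanE; case: (z j); case: (z' j).
Qed.

Definition chained (n m : nat) (D : config k) : Prop :=
  [/\ state D = chain_base + m, in_head D = 0, out D = blank_tape &
   forall j, pos (work D j) = (if j == ord0 then (n - m).+1 else 0) /\
             forall c, cell (work D j) c = (c == 0)].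

Lemma chain_scan n m D j : chained n m D -> scan (work D j) = chain_read j.
Proof.
by move=> [_ _ _ /(_ j)[pj cj]]; rewrite /scan cj pj ffunE; case: (j == ord0).
Qed.

Lemma start_step n p : exists2 D,
  step (M := Machine (assemble n)) p (init (Machine (assemble n))) = Some D &
  chained n n D.
Proof.
rewrite (@step_rule _ _ _ _ (start_rule n)).
- eexists; first by []. split=> //= j; rewrite !ffunE subnn; split; last by [].
  by case: (j == ord0).
- exact: mem_head.
- by apply/and3P; split=> //=; apply/forallP => j; rewrite ffunE.
- move=> r /assembleP rP /and3P[/eqP + _ _]; rewrite /init/=.
  by case: rP => [->|[m _ ->]|->|[K [z [a [Kc _ ->]]]]].
Qed.

Lemma chain_step n p m D : m < n -> chained n m.+1 D -> exists2 D',
  step (M := Machine (assemble n)) p D = Some D' & chained n m D'.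
Proof.
move=> mn cD; have sc j := chain_scan j cD; have [sD hD oD wD] := cD.
rewrite (@step_rule _ _ _ _ (chain_rule m)).
- eexists; first by []. split; rewrite /= ?act_stay // => j; have [pj cj] := wD j;
  rewrite !ffunE; split.
    by rewrite pj; case: (j == ord0); rewrite //= -subSn.
  by move=> c; rewrite cj pj; case: eqP => // ->; case: (j == ord0).
- rewrite inE mem_cat; apply/or3P; constructor 2; apply/mapP.
  by exists m; rewrite // mem_rev mem_iota.
- by apply/and3P; split; rewrite /= ?sD ?hD//; apply/forallP => j; rewrite sc.
- move=> r /assembleP rP /and3P[/eqP + _ _]; rewrite sD.
  case: rP => [->|[m' _ ->]|->|[K [z [a [Kc _ ->]]]]]//=; rewrite /chain_base.
  + by rewrite !addnS !addSn => -[/addnI[->]].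
  + by lia.
  + have : label K < chain_base by rewrite label_le// inE Kc orbT.
    by rewrite /chain_base; lia.
Qed.

Lemma enter_step n p D : chained n 0 D -> exists2 D',
  step (M := Machine (assemble n)) p D = Some D' &
  tracks (Conf [:: c0] (stack 0 (fun=> 0) [:: n]) 0 blank_tape) D'.
Proof.
move=> cD; have sc j := chain_scan j cD; have [sD hD oD wD] := cD.
rewrite (@step_rule _ _ _ _ enter_rule).
- eexists; first by []. split; rewrite /= ?act_stay // => j; have [pj cj] := wD j;
  rewrite !ffunE; split.
    by rewrite pj /stack/= subn0; case: j {pj cj} => -[|j] ?//=; rewrite nth_nil.
  by move=> c; rewrite cj pj; case: eqP => // ->; case: (j == ord0).
- by rewrite inE mem_cat inE eqxx !orbT.
- by apply/and3P; split; rewrite /= ?sD ?hD ?addn0//; apply/forallP => j; rewrite sc.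
- move=> r /assembleP rP /and3P[/eqP + _ _]; rewrite sD.
  case: rP => [->|[m' _ ->]|->|[K [z [a [Kc _ ->]]]]]//=; rewrite /chain_base.
  + by lia.
  + have : label K < chain_base by rewrite label_le// inE Kc orbT.
    by rewrite /chain_base; lia.
Qed.

Lemma assemble_start n p : exists t,
  tracks (Conf [:: c0] (stack 0 (fun=> 0) [:: n]) 0 blank_tape)
    (run (Machine (assemble n)) p t) /\
  forall t', t' < t -> step p (run (Machine (assemble n)) p t') <> None.
Proof.
pose M := Machine (assemble n).
have [D1 s1 c1] := start_step n p.
have chain j : j <= n -> chained n (n - j) (run M p j.+1) /\
    forall t', t' < j.+1 -> step p (run M p t') <> None.
  elim: j => [|j IH] jn.
    by rewrite subn0 /run/= -/M s1; split=> // -[|//] _; rewrite /= s1.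
  have [cj nj] := IH (ltnW jn).
  have jn' : n - j.+1 < n by lia.
  rewrite -[n - j](_ : (n - j.+1).+1 = _) in cj; last by lia.
  have [D' sD cD'] := chain_step p jn' cj.
  have rE : run M p j.+2 = D' by rewrite /run iterS -/(run M p j.+1) sD.
  rewrite rE; split=> // t'; rewrite ltnS leq_eqVlt => /orP[/eqP->|/nj//].
  by rewrite sD.
have [cn nn] := chain n (leqnn n); rewrite subnn in cn.
have [D' sD cD'] := enter_step p cn.
exists n.+2; have -> : run M p n.+2 = D' by rewrite /run iterS -/(run M p n.+1) sD.
split=> // t'; rewrite ltnS leq_eqVlt => /orP[/eqP->|/nn//].
by rewrite sD.
Qed.

(** After a start phase of [T] steps the machine and the counter program run in lockstep. The start
    phase itself never halts, hence the equivalence. *)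
Lemma assemble_run n p : let M := Machine (assemble n) in
  let C i := iter i (cstep p) (Conf [:: c0] (stack 0 (fun=> 0) [:: n]) 0 blank_tape) in
  exists T, (forall i, out (run M p (T + i)) = outp (C i)) /\
    (halts M p <-> exists i, prog (C i) = [::]).
Proof.
move=> M C; have [T [tT nT]] := assemble_start n p.
have Cc i : prog (C i) \in controls.
  elim: i => [|i IH]; last exact: next_controls.
  by rewrite inE mem_conts orbT.
have tr i : tracks (C i) (run M p (T + i)).
  elim: i => [|i IH]; first by rewrite addn0.
  rewrite addnS /run iterS -/(run M p (T + i)).
  have [Ci|Ci] := eqVneq (prog (C i)) [::].
    (* An exhausted program stands still under [cstep], as does the halted machine. *)
    rewrite (tracks_halt n p IH Ci)/=; case: IH => sD hD oD wD.
    by split; rewrite /= ?Ci/= ?act_stay -?Ci.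
  have := Cc i; rewrite inE (negPf Ci) /= => {}Ci.
  by have [D' -> ] := tracks_step n p IH Ci.
exists T; split=> [i|]; first by case: (tr i).
split=> [[t st]|[i Ci]]; last by exists (T + i); exact: tracks_halt (tr i) Ci.
have Tt : T <= t by rewrite leqNgt; apply/negP => /nT.
exists (t - T); apply/eqP; apply: contraTT isT => Ci.
have := Cc (t - T); rewrite inE (negPf Ci) /= => {}Ci.
have [D' + _] := tracks_step n p (tr (t - T)) Ci.
by rewrite subnKC// st.
Qed.
End Assembly.

Fixpoint output (ow : bool) (f : seq nat -> nat) (p : baire) (m : nat) : tape :=
  if m is m'.+1 then emit ow (f (prefix p m)) (output ow f p m') else blank_tape.

Section DriverRun.
Variables (ow : bool) (f : nat * seq nat -> nat) (c : code).
Hypothesis cf : forall x, eval c (enc x) = enc (f x).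
Variables (n : nat) (p : baire).

Let g m := f (n, prefix p m).
Let C i := iter i (cstep p)
  (Conf [:: Seq (Inc 1) (driver ow c)] (stack 0 (fun=> 0) [:: n]) 0 blank_tape).
Let A b m := Conf [:: driver ow c]
  (stack 0 (fun=> 0) [:: n; b; enc (prefix p m)]) m (output ow (fun x => f (n, x)) p m).

Lemma driver_stage m : exists k, reach p k.+1 (A 1 m) (A (g m.+1 < 4 : nat) m.+1).
Proof.
have [k [Ek ok]] := stage_reach ow c (fun=> 0) p [:: driver ow c] m
  (output ow (fun x => f (n, x)) p m) n (enc (prefix p m)).
exists k.
have E1 : cstep p (A 1 m) = Conf [:: stage ow c; driver ow c]
    (stack 0 (fun=> 0) [:: n; 1;
    enc (prefix p m)]) m (output ow (fun x => f (n, x)) p m).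
  by rewrite /cstep/= act_stay.
apply: reach_step; rewrite E1//; split=> //; rewrite Ek.
have -> : (cantor (in_cell p m) (enc (prefix p m))).+1 = enc (prefix p m.+1) by [].
have -> : cantor n (enc (prefix p m.+1)) = enc (n, prefix p m.+1) by [].
by rewrite cf.
Qed.

Lemma driver_first : C 2 = A 1 0.
Proof.
rewrite /C /A -[[:: n; 1; enc _]]/([:: n; 1] ++ nseq 1 0) stack_pad.
rewrite /cstep/= !act_stay; congr Conf; apply/funext => -[|[|j]]//=.
by rewrite /stack/= !nth_nil.
Qed.

Lemma driver_reaches m : (forall m', m' < m -> g m'.+1 < 4) ->
  exists2 i, m <= i & C i = A 1 m.
Proof.
elim: m => [|m IH] gm; first by exists 2; rewrite // driver_first.
have [i mi Ci] := IH (fun m' h => gm m' (ltnW h)).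
have [k [Ek _]] := driver_stage m; exists (k.+1 + i); first by lia.
by rewrite /C iterD -/(C i) Ci Ek gm.
Qed.

(** Strong induction on [d]: either the time lies within the current stage, where the tape has not
    changed yet, or a whole stage can be split off. *)
Lemma driver_outp : (forall m, g m.+1 < 4) -> forall d m i, C i = A 1 m ->
  exists2 m', m <= m' & outp (C (i + d)) = output ow (fun x => f (n, x)) p m'.
Proof.
move=> gm d; elim/ltn_ind: d => d IH m i Ci.
have [k [Ek ok]] := driver_stage m; rewrite gm in Ek.
have [dk|kd] := ltnP d k.+1.
  by exists m => //; rewrite /C addnC iterD -/(C i) Ci ok.
have Ck : C (i + k.+1) = A 1 m.+1 by rewrite /C addnC iterD -/(C i) Ci Ek.
have [|m' mm' E] := IH (d - k.+1) _ _ _ Ck; first by lia.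
by exists m'; [exact: ltnW | rewrite -E; congr (outp (C _)); lia].
Qed.

Lemma driver_prog : (exists i, prog (C i) = [::]) <-> exists m, 4 <= g m.+1.
Proof.
split=> [[i Ci]|].
  apply: contrapT => no.
  have gm m : g m.+1 < 4 by rewrite ltnNge; apply/negP => gm; apply: no; exists m.
  (* The loop would be entered again at some [j] after [i], whereas an empty program stays empty. *)
  have [j ij Cj] := driver_reaches (m := i) (fun m _ => gm m).
  have : prog (C j) = [::].
    rewrite -(subnK ij); elim: (j - i) => [//|d IH].
    by rewrite addSn /C iterS -/(C (d + i)) [prog _]/= IH.
  by rewrite Cj.
move=> ex; case: (@ex_minnP (fun m => 4 <= g m.+1) ex) => m gm mmin.
have [|i _ Ci] := driver_reaches (m := m).
  by move=> m' m'm; rewrite ltnNge; apply/negP => /mmin; rewrite leqNgt m'm.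
have [k [Ek _]] := driver_stage m; exists (k.+1 + i).+1.
by rewrite /C iterS iterD -/(C i) Ci Ek ltnNge gm.
Qed.
End DriverRun.

(** * Closure properties of the primitive recursive functions *)

Section Closure.
Context (X : Type) {eX : encodable X} (A : Type) {eA : encodable A}
  (B : Type) {eB : encodable B}.

Lemma pr_ext (f g : X -> A) : f =1 g -> primrec f -> primrec g.
Proof. by move=> fg [c cf]; exists c => x; rewrite cf fg. Qed.

Lemma pr_comp (g : A -> B) (f : X -> A) :
  primrec g -> primrec f -> primrec (fun x => g (f x)).
Proof. by move=> [c cg] [d df]; exists (CComp c d) => x /=; rewrite df cg. Qed.

Lemma pr_id : primrec (fun x : X => x).
Proof. by exists (CPair CFst CSnd) => x /=; rewrite uncantorK. Qed.

Lemma pr_const (a : A) : primrec (fun _ : X => a).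
Proof.
exists (iter (enc a) (CComp CSucc) CZero) => x.
by elim: (enc a) => //= n ->.
Qed.

Lemma pr_pair (f : X -> A) (g : X -> B) :
  primrec f -> primrec g -> primrec (fun x => (f x, g x)).
Proof. by move=> [c cf] [d dg]; exists (CPair c d) => x /=; rewrite cf dg. Qed.

Lemma pr_fst (f : X -> A * B) : primrec f -> primrec (fun x => (f x).1).
Proof. by move=> [c cf]; exists (CComp CFst c) => x /=; rewrite cf cantorK. Qed.

Lemma pr_snd (f : X -> A * B) : primrec f -> primrec (fun x => (f x).2).
Proof. by move=> [c cf]; exists (CComp CSnd c) => x /=; rewrite cf cantorK. Qed.

Lemma pr_succ (f : X -> nat) : primrec f -> primrec (fun x => (f x).+1).
Proof. by move=> [c cf]; exists (CComp CSucc c) => x /=; rewrite cf. Qed.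

(** [CIter] admits no parameter, so the parameter is carried along as the first component of the
    iterated pair. *)
Lemma pr_iter (n : X -> nat) (g : X -> A -> A) (f : X -> A) :
  primrec (fun w : X * A => g w.1 w.2) -> primrec n -> primrec f ->
  primrec (fun x => iter (n x) (g x) (f x)).
Proof.
move=> [c cg] [d dn] [e ef].
exists (CComp CSnd (CComp (CIter (CPair CFst c)) (CPair d (CPair (CPair CFst CSnd) e)))).
move=> x /=; rewrite !cantorK/= uncantorK dn ef.
have E (m : nat) : iter m (fun y => cantor (uncantor y).1 (eval c y))
    (cantor (enc x) (enc (f x))) = cantor (enc x) (enc (iter m (g x) (f x))).
  elim: m => //= m ->; rewrite cantorK/=; congr cantor.
  exact: (cg (x, iter m (g x) (f x))).
by rewrite E cantorK.
Qed.

Lemma pr_cons (f : X -> A) (g : X -> seq A) :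
  primrec f -> primrec g -> primrec (fun x => f x :: g x).
Proof.
by move=> [c cf] [d dg]; exists (CComp CSucc (CPair c d)) => x /=; rewrite cf dg.
Qed.

(** Being primitive recursive depends on codes only, so booleans and lists may be exchanged for
    numbers. *)
Lemma pr_enc (f : X -> A) : primrec (fun x => enc (f x)) <-> primrec f.
Proof. by split=> -[c cf]; exists c. Qed.
End Closure.

Lemma pr_app2 X {eX : encodable X} A {eA : encodable A} B {eB : encodable B}
    D {eD : encodable D} (h : A -> B -> D) (f : X -> A) (g : X -> B) :
  primrec (fun w => h w.1 w.2) -> primrec f -> primrec g ->
  primrec (fun x => h (f x) (g x)).
Proof. by move=> ph pf pg; have := pr_comp ph (pr_pair pf pg). Qed.

Lemma pr_app3 X {eX : encodable X} A {eA : encodable A} B {eB : encodable B}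
    D {eD : encodable D} E {eE : encodable E} (h : A -> B -> D -> E)
    (f : X -> A) (g : X -> B) (k : X -> D) :
  primrec (fun w => h w.1 w.2.1 w.2.2) -> primrec f -> primrec g -> primrec k ->
  primrec (fun x => h (f x) (g x) (k x)).
Proof. by move=> ph pf pg pk; have := pr_comp ph (pr_pair pf (pr_pair pg pk)). Qed.

Lemma pr_eval X {eX : encodable X} c (f : X -> nat) :
  primrec f -> primrec (fun x => eval c (f x)).
Proof. by apply: pr_comp; exists c. Qed.

Lemma pr_cantor X {eX : encodable X} (f g : X -> nat) :
  primrec f -> primrec g -> primrec (fun x => cantor (f x) (g x)).
Proof. by move=> hf hg; case: (pr_pair hf hg) => c ?; exists c. Qed.

Lemma pr_uncantor X {eX : encodable X} (f : X -> nat) :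
  primrec f -> primrec (fun x => uncantor (f x)).
Proof. by move=> [c cf]; exists c => x;
  rewrite cf/= /enc/= /encodable_prod uncantorK. Qed.

Lemma pr_pred X {eX : encodable X} (f : X -> nat) :
  primrec f -> primrec (fun x => (f x).-1).
Proof.
move=> pf; apply: (@pr_ext _ _ _ _ (fun x =>
  (iter (f x) (fun w : nat * nat => (w.1.+1, w.1)) (0, 0)).2)).
  move=> x; suff -> n : iter n (fun w : nat * nat => (w.1.+1, w.1)) (0, 0) = (n, n.-1) by [].
  by elim: n => //= n ->.
apply: pr_snd; apply: (@pr_iter _ _ _ _ f (fun _ w => (w.1.+1, w.1))) => //.
  by apply: pr_pair; [apply: pr_succ|]; apply: pr_fst; apply: pr_snd; exact: pr_id.
exact: pr_const.
Qed.

Lemma pr_if X {eX : encodable X} A {eA : encodable A} (b : X -> bool) (f g : X -> A) :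
  primrec b -> primrec f -> primrec g -> primrec (fun x => if b x then f x else g x).
Proof.
move=> pb pf pg; apply: (@pr_ext _ _ _ _ (fun x => iter (b x) (fun _ => f x) (g x))).
  by move=> x; case: (b x).
apply: (@pr_iter _ _ _ _ (fun x => b x : nat) (fun x _ => f x)) => //.
by apply: pr_comp pf _; apply: pr_fst; exact: pr_id.
Qed.

Lemma pr_eq0 X {eX : encodable X} (f : X -> nat) :
  primrec f -> primrec (fun x => f x == 0).
Proof.
move=> pf; apply: (@pr_ext _ _ _ _ (fun x => iter (f x) (fun _ => false) true)).
  by move=> x; case: (f x).
by apply: (@pr_iter _ _ _ _ f (fun _ _ => false)) => //; exact: pr_const.
Qed.

Lemma pr_add X {eX : encodable X} (f g : X -> nat) :
  primrec f -> primrec g -> primrec (fun x => f x + g x).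
Proof.
move=> pf pg; apply: (@pr_ext _ _ _ _ (fun x => iter (f x) succn (g x))).
  by move=> x; rewrite iter_succn addnC.
apply: (@pr_iter _ _ _ _ f (fun _ => succn)) => //.
by apply: pr_succ; apply: pr_snd; exact: pr_id.
Qed.

Lemma pr_sub X {eX : encodable X} (f g : X -> nat) :
  primrec f -> primrec g -> primrec (fun x => f x - g x).
Proof.
move=> pf pg; apply: (@pr_ext _ _ _ _ (fun x => iter (g x) predn (f x))).
  by move=> x; rewrite iter_predn.
apply: (@pr_iter _ _ _ _ g (fun _ => predn)) => //.
by apply: (@pr_pred _ _ (fun w => w.2)); apply: pr_snd; exact: pr_id.
Qed.

Lemma pr_leq X {eX : encodable X} (f g : X -> nat) :
  primrec f -> primrec g -> primrec (fun x => f x <= g x).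
Proof. by move=> pf pg; apply: pr_eq0; exact: pr_sub. Qed.

Lemma pr_not X {eX : encodable X} (b : X -> bool) :
  primrec b -> primrec (fun x => ~~ b x).
Proof.
move=> pb; apply: (@pr_ext _ _ _ _ (fun x => if b x then false else true)).
  by move=> x; case: (b x).
by apply: pr_if => //; exact: pr_const.
Qed.

Lemma pr_and X {eX : encodable X} (b c : X -> bool) :
  primrec b -> primrec c -> primrec (fun x => b x && c x).
Proof.
move=> pb pc; apply: (@pr_ext _ _ _ _ (fun x => if b x then c x else false)).
  by move=> x; case: (b x).
by apply: pr_if => //; exact: pr_const.
Qed.

Lemma pr_or X {eX : encodable X} (b c : X -> bool) :
  primrec b -> primrec c -> primrec (fun x => b x || c x).
Proof.
move=> pb pc; apply: (@pr_ext _ _ _ _ (fun x => if b x then true else c x)).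
  by move=> x; case: (b x).
by apply: pr_if => //; exact: pr_const.
Qed.

Lemma pr_eqn X {eX : encodable X} (f g : X -> nat) :
  primrec f -> primrec g -> primrec (fun x => f x == g x).
Proof.
move=> pf pg; apply: (@pr_ext _ _ _ _ (fun x => (f x <= g x) && (g x <= f x))).
  by move=> x; rewrite eqn_leq.
by apply: pr_and; exact: pr_leq.
Qed.

Lemma pr_odd X {eX : encodable X} (f : X -> nat) :
  primrec f -> primrec (fun x => odd (f x)).
Proof.
move=> pf; apply: (@pr_ext _ _ _ _ (fun x => iter (f x) negb false)).
  by move=> x; elim: (f x) => //= n ->.
apply: (@pr_iter _ _ _ _ f (fun _ => negb)) => //; last exact: pr_const.
by apply: pr_not; apply: pr_snd; exact: pr_id.
Qed.

Lemma pr_half X {eX : encodable X} (f : X -> nat) :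
  primrec f -> primrec (fun x => (f x)./2).
Proof.
move=> pf; apply: (@pr_ext _ _ _ _ (fun x =>
  (iter (f x) (fun w : nat * bool => (w.1 + w.2, ~~ w.2)) (0, false)).1)).
  move=> x; suff -> n : iter n (fun w : nat * bool => (w.1 + w.2, ~~ w.2)) (0, false)
    = (n./2, odd n) by [].
  by elim: n => //= n ->; rewrite /= uphalf_half addnC.
apply: pr_fst; apply: (@pr_iter _ _ _ _ f (fun _ (w : nat * bool) => (w.1 + w.2, ~~ w.2))) => //.
  have p2 : primrec (fun w : X * (nat * bool) => w.2) by apply: pr_snd; exact: pr_id.
  apply: pr_pair; last by apply: pr_not; apply: pr_snd.
  by apply: pr_add; [exact: pr_fst | exact: (pr_snd p2)].
exact: pr_const.
Qed.

Section Sequences.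
Context (X : Type) {eX : encodable X} (A : Type) {eA : encodable A}
  (B : Type) {eB : encodable B}.

(** The code of a list bounds its length, so that many rounds of [pop] suffice; on the empty list
    [pop] is idle. *)
Lemma pr_foldl (g : X -> A -> B -> A) (z : X -> A) (s : X -> seq B) :
  primrec (fun w : X * (A * B) => g w.1 w.2.1 w.2.2) -> primrec z -> primrec s ->
  primrec (fun x => foldl (g x) (z x) (s x)).
Proof.
move=> [c cg] pz ps; apply/pr_enc.
pose pop (y : nat) (w : nat * nat) := if w.2 == 0 then w else
  (eval c (cantor y (cantor w.1 (uncantor w.2.-1).1)), (uncantor w.2.-1).2).
apply: (@pr_ext _ _ _ _ (fun x =>
  (iter (enc (s x)) (pop (enc x)) (enc (z x), enc (s x))).1)).
  move=> x; have le : size (s x) <= enc (s x).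
    elim: (s x) => //= b t IH; rewrite ltnS (leq_trans IH)// cantorE.
    exact: leq_addr.
  move: le; move: {1 2}(enc (s x)) => n.
  elim: (s x) (z x) n => [|b t IH] a n.
    by move=> _; elim: n => // n; rewrite iterSr.
  case: n => // n /IH {}IH; rewrite iterSr /= -IH /pop/= cantorK/=.
  by have /= -> := cg (x, (a, b)).
apply: pr_fst; apply: (@pr_iter _ _ _ _ (fun x => enc (s x)) (fun x => pop (enc x))).
- rewrite /pop.
  have p1 : primrec (fun w : X * (nat * nat) => enc w.1).
    by apply/pr_enc; apply: pr_fst; exact: pr_id.
  have p2 : primrec (fun w : X * (nat * nat) => w.2) by apply: pr_snd; exact: pr_id.
  have p22 := pr_snd p2.
  apply: pr_if; [exact: pr_eq0|by []|].
  have pu := pr_uncantor (pr_pred p22).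
  apply: pr_pair; last exact: pr_snd.
  by apply: pr_eval; apply: pr_cantor => //; apply: pr_cantor; apply: pr_fst.
- exact/pr_enc.
- by apply: pr_pair; apply/pr_enc.
Qed.
End Sequences.

Lemma pr_rev X {eX : encodable X} A {eA : encodable A} (s : X -> seq A) :
  primrec s -> primrec (fun x => rev (s x)).
Proof.
move=> ps; apply: (@pr_ext _ _ _ _ (fun x => foldl (fun t a => a :: t) [::] (s x))).
  move=> x; rewrite -[rev _]cats0; elim: (s x) [::] => //= a t IH u.
  by rewrite IH rev_cons cat_rcons.
apply: (@pr_foldl _ _ _ _ _ _ (fun _ t a => a :: t)) => //; last exact: pr_const.
have p2 : primrec (fun w : X * (seq A * A) => w.2) by apply: pr_snd; exact: pr_id.
by apply: pr_cons; [exact: pr_snd | exact: pr_fst].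
Qed.

Lemma pr_foldr X {eX : encodable X} A {eA : encodable A} B {eB : encodable B}
    (g : X -> B -> A -> A) (z : X -> A) (s : X -> seq B) :
  primrec (fun w : X * (B * A) => g w.1 w.2.1 w.2.2) -> primrec z -> primrec s ->
  primrec (fun x => foldr (g x) (z x) (s x)).
Proof.
move=> pg pz ps; apply: (@pr_ext _ _ _ _ (fun x =>
  foldl (fun a b => g x b a) (z x) (rev (s x)))); first by move=> x; rewrite foldl_rev.
apply: (@pr_foldl _ _ _ _ _ _ (fun x a b => g x b a)) => //; last exact: pr_rev.
have p2 : primrec (fun w : X * (A * B) => w.2) by apply: pr_snd; exact: pr_id.
apply: (pr_app3 pg); [by apply: pr_fst; exact: pr_id | exact: pr_snd | exact: pr_fst].
Qed.

Ltac pr_other := fail.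
Ltac pr_step :=
  first
  [ assumption
  | match goal with
    | H : primrec ?f |- primrec (fun x => ?f (@?t x)) => apply: (pr_comp H)
    end
  | lazymatch goal with
    | |- primrec (fun x => x) => apply: pr_id
    | |- primrec (fun x => (_, _)) => apply: pr_pair
    | |- primrec (fun x => fst _) => apply: pr_fst
    | |- primrec (fun x => snd _) => apply: pr_snd
    | |- primrec (fun x => nat_of_bool _) => apply/pr_enc
    | |- primrec (fun x => if _ then _ else _) => apply: pr_if
    | |- primrec (fun x => _ :: _) => apply: pr_cons
    | |- primrec (fun x => cantor _ _) => apply: pr_cantor
    | |- primrec (fun x => uncantor _) => apply: pr_uncantor
    end
  | apply: pr_const
  | lazymatch goal with
    | |- primrec (fun x => S _) => apply: pr_succ
    | |- primrec (fun x => predn _) => apply: pr_pred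
    | |- primrec (fun x => addn _ _) => apply: pr_add
    | |- primrec (fun x => subn _ _) => apply: pr_sub
    | |- primrec (fun x => leq _ _) => apply: pr_leq
    | |- primrec (fun x => eq_op _ _) => apply: pr_eqn
    | |- primrec (fun x => negb _) => apply: pr_not
    | |- primrec (fun x => andb _ _) => apply: pr_and
    | |- primrec (fun x => orb _ _) => apply: pr_or
    | |- primrec (fun x => odd _) => apply: pr_odd
    | |- primrec (fun x => half _) => apply: pr_half
    | |- primrec (fun x => iter _ _ _) => apply: pr_iter
    | |- primrec (fun x => foldl _ _ _) => apply: pr_foldl
    | |- primrec (fun x => foldr _ _ _) => apply: pr_foldr
    | |- primrec (fun x => rev _) => apply: pr_rev
    end
  | pr_other
  | lazymatch goal with
    | |- primrec (fun _ => _) => fail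
    | |- @primrec ?X ?A ?eX ?eA ?f => change (@primrec X A eX eA (fun x => f x))
    end ].
Ltac pr := repeat pr_step.

Section MoreSequences.
Context (X : Type) {eX : encodable X} (A : Type) {eA : encodable A}
  (B : Type) {eB : encodable B}.

Lemma pr_map (g : X -> B -> A) (s : X -> seq B) :
  primrec (fun w : X * B => g w.1 w.2) -> primrec s ->
  primrec (fun x => [seq g x b | b <- s x]).
Proof.
move=> pg ps; apply: (@pr_ext _ _ _ _ (fun x => foldr (fun b t => g x b :: t) [::] (s x))).
  by move=> x; elim: (s x) => //= b t ->.
by pr; apply: (pr_app2 pg); pr.
Qed.

Lemma pr_cat (s t : X -> seq A) :
  primrec s -> primrec t -> primrec (fun x => s x ++ t x).
Proof.
move=> ps pt; apply: (@pr_ext _ _ _ _ (fun x => foldr (fun a u => a :: u) (t x) (s x))).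
  by move=> x; elim: (s x) => //= b u ->.
pr.
Qed.

Lemma pr_has (g : X -> B -> bool) (s : X -> seq B) :
  primrec (fun w : X * B => g w.1 w.2) -> primrec s ->
  primrec (fun x => has (g x) (s x)).
Proof.
move=> pg ps; apply: (@pr_ext _ _ _ _ (fun x => foldr (fun b t => g x b || t) false (s x))).
  by move=> x; elim: (s x) => //= b t ->.
by pr; apply: (pr_app2 pg); pr.
Qed.

Lemma pr_all (g : X -> B -> bool) (s : X -> seq B) :
  primrec (fun w : X * B => g w.1 w.2) -> primrec s ->
  primrec (fun x => all (g x) (s x)).
Proof.
move=> pg ps; apply: (@pr_ext _ _ _ _ (fun x => foldr (fun b t => g x b && t) true (s x))).
  by move=> x; elim: (s x) => //= b t ->.
by pr; apply: (pr_app2 pg); pr.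
Qed.

Lemma pr_count (g : X -> B -> bool) (s : X -> seq B) :
  primrec (fun w : X * B => g w.1 w.2) -> primrec s ->
  primrec (fun x => count (g x) (s x)).
Proof.
move=> pg ps; apply: (@pr_ext _ _ _ _ (fun x => foldr (fun b n => g x b + n) 0 (s x))).
  by move=> x; elim: (s x) => //= b t ->.
by pr; apply: (pr_app2 pg); pr.
Qed.

Lemma pr_size (s : X -> seq A) : primrec s -> primrec (fun x => size (s x)).
Proof.
move=> ps; apply: (@pr_ext _ _ _ _ (fun x => foldr (fun _ n => n.+1) 0 (s x))).
  by move=> x; elim: (s x) => //= b t ->.
pr.
Qed.

Lemma pr_sumn (s : X -> seq nat) : primrec s -> primrec (fun x => sumn (s x)).
Proof. by move=> ps; rewrite /sumn; pr. Qed.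

Lemma pr_iota (n : X -> nat) : primrec n -> primrec (fun x => iota 0 (n x)).
Proof.
move=> pn; apply: (@pr_ext _ _ _ _ (fun x => rev
  (iter (n x) (fun w : nat * seq nat => (w.1.+1, w.1 :: w.2)) (0, [::])).2)).
  move=> x; suff -> m : iter m (fun w : nat * seq nat => (w.1.+1, w.1 :: w.2)) (0, [::])
      = (m, rev (iota 0 m)) by rewrite revK.
  by elim: m => // m; rewrite iterS => ->; rewrite -addn1 iotaD rev_cat.
pr.
Qed.

Lemma pr_behead (s : X -> seq A) : primrec s -> primrec (fun x => behead (s x)).
Proof.
move=> ps; apply/pr_enc.
apply: (@pr_ext _ _ _ _ (fun x => (uncantor (enc (s x)).-1).2)).
  by move=> x; case: (s x) => //= a t; rewrite cantorK.
by pr; apply/pr_enc.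
Qed.

Lemma pr_head (s : X -> seq nat) : primrec s -> primrec (fun x => head 0 (s x)).
Proof.
move=> ps; apply: (@pr_ext _ _ _ _ (fun x => (uncantor (enc (s x)).-1).1)).
  by move=> x; case: (s x) => //= a t; rewrite cantorK.
by pr; apply/pr_enc.
Qed.
End MoreSequences.

Lemma pr_nth X {eX : encodable X} (s : X -> seq nat) (i : X -> nat) :
  primrec s -> primrec i -> primrec (fun x => nth 0 (s x) (i x)).
Proof.
move=> ps pi; apply: (@pr_ext _ _ _ _ (fun x => head 0 (iter (i x) behead (s x)))).
  move=> x; elim: (i x) (s x) => [|n IH] [|a t] //.
    by rewrite iterSr /= IH nth_nil.
  by rewrite iterSr /= IH.
by apply: pr_head; pr; apply: pr_behead; pr.
Qed.

Lemma pr_entry X {eX : encodable X} (f g : X -> nat) :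
  primrec f -> primrec g -> primrec (fun x => entry (f x) (g x)).
Proof. by rewrite /entry => pf pg; pr. Qed.

Ltac pr_user := fail.
Ltac pr_other ::=
  lazymatch goal with
  | |- primrec (fun x => map _ _) => apply: pr_map
  | |- primrec (fun x => cat _ _) => apply: pr_cat
  | |- primrec (fun x => has _ _) => apply: pr_has
  | |- primrec (fun x => all _ _) => apply: pr_all
  | |- primrec (fun x => count _ _) => apply: pr_count
  | |- primrec (fun x => size _) => apply: pr_size
  | |- primrec (fun x => sumn _) => apply: pr_sumn
  | |- primrec (fun x => iota 0 _) => apply: pr_iota
  | |- primrec (fun x => nth 0 _ _) => apply: pr_nth
  | |- primrec (fun x => entry _ _) => apply: pr_entry
  | _ => pr_user
  end.

(** * Computing the numbers of the driver machines *)

(** The coding read by [entry]. Unlike [enc] on lists it does not mark the end, so machine numbers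
    store lengths separately. *)
Definition list_code (s : seq nat) : nat := foldr cantor 0 s.

Lemma entry_list_code s i : i < size s -> entry (list_code s) i = nth 0 s i.
Proof.
elim: s i => [//|a s IH] [_|i /IH /= <-]; first by rewrite /entry cantorK.
by rewrite /entry iterSr /= cantorK.
Qed.

Lemma pr_list_code X {eX : encodable X} (s : X -> seq nat) :
  primrec s -> primrec (fun x => list_code (s x)).
Proof. by rewrite /list_code => ps; pr. Qed.

Ltac pr_user ::=
  lazymatch goal with
  | |- primrec (fun x => list_code _) => apply: pr_list_code
  end.

Lemma machine_of_list_code k cs :
  machine_of_nat (list_code [:: k; size cs; list_code cs]) =
  Machine [seq rule_of_nat k c | c <- cs].
Proof.
rewrite /machine_of_nat !entry_list_code//=; congr Machine.
apply: (@eq_from_nth _ (rule_of_nat k 0)) => [|j]; rewrite !size_map size_iota// => jcs.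
by rewrite !(nth_map 0) ?size_iota// nth_iota// entry_list_code.
Qed.

(** An s-m-n theorem. Only the start rule and the chain depend on [n], and their codes are
    arithmetic in [n]; the other rules contribute the fixed list [rest]. *)
Lemma number_assemble k c0 : exists2 h, primrec h &
  forall n, machine_of_nat (h n) = Machine (assemble k c0 n).
Proof.
have [cR cRE] := entry_onto_ffun (chain_read k).
have [c1 c1E] := entry_onto_ffun [ffun _ : 'I_k.+1 => 1].
have [c0' c0E] := entry_onto_ffun [ffun _ : 'I_k.+1 => 0].
have [cM cME] := entry_onto_ffun [ffun j : 'I_k.+1 => if j == ord0 then 2 else 1].
have [rest restE] : exists s, [seq rule_of_nat k.+1 c | c <- s] =
    enter_rule k c0 :: main_rules k c0.
  elim: (_ :: _) => [|r rs [s <-]]; first by exists [::].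
  by have [c <-] := rule_of_nat_onto r; exists (c :: s).
set B := chain_base c0.
(* As moves, 0, 1 and 2 are [Left], [Stay] and [Right]; the 0 before the last entry means that
   nothing is written on the output. *)
pose start n := list_code [:: 0; 0; c0'; B + n; 1; c1; cM; 0; 1].
pose chain m := list_code [:: B + m.+1; 0; cR; B + m; 1; cR; cM; 0; 1].
pose codes n := start n :: [seq chain m | m <- rev (iota 0 n)] ++ rest.
exists (fun n => list_code [:: k.+1; size (codes n); list_code (codes n)]).
  have pcodes : primrec codes.
    by rewrite /codes /start /chain; pr.
  by pr.
move=> n; rewrite machine_of_list_code; congr Machine.
rewrite /codes /= map_cat restE /assemble; congr (_ :: _ ++ _).
  rewrite /rule_of_nat /start !entry_list_code//= /start_rule; congr Rule;
  by apply/ffunP => j; rewrite !ffunE ?c0E ?c1E ?cME ?ffunE//; case: (j == ord0).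
rewrite -map_comp; apply: eq_map => m /=.
rewrite /rule_of_nat /chain !entry_list_code//= /chain_rule; congr Rule;
by apply/ffunP => j; rewrite !ffunE ?cRE ?cME ?ffunE//; case: (j == ord0).
Qed.

(** All machines below come from here. Those whose halting matters use the parameter; those whose
    output matters fix it to 0. *)
Theorem driver_machine (ow : bool) (f : nat * seq nat -> nat) : primrec f ->
  exists2 h, primrec h & forall n, let M := machine_of_nat (h n) in
    (ow -> one_way M) /\ forall p,
    (halts M p <-> exists m, 4 <= f (n, prefix p m.+1)) /\
    ((forall m, f (n, prefix p m.+1) < 4) -> forall m, exists t0, forall t, t0 <= t ->
      exists2 m', m <= m' & out (run M p t) = output ow (fun x => f (n, x)) p m').
Proof.
move=> [c cf]; have [k fk] := driver_fits ow c.
have [h ph hE] := number_assemble k (Seq (Inc 1) (driver ow c)).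
exists h => // n M; rewrite /M hE; split=> [|p]; first exact: one_way_assemble fk _.
have [T [outT haltT]] := assemble_run fk n p.
split; first by rewrite haltT; exact: (driver_prog ow cf).
move=> fm m.
have [i _ Ci] := driver_reaches ow cf (m := m) (fun m' _ => fm m').
exists (T + i) => t Tt; rewrite -(subnKC Tt) -addnA outT.
exact: (driver_outp cf fm).
Qed.

(** * Simulation of machines *)

(* The memory is the list of all writes, most recent first. *)
Definition lookup (l : seq (nat * nat)) (key : nat) : nat :=
  foldr (fun e v => if e.1 == key then e.2 else v) 0 l.

Lemma pr_lookup X {eX : encodable X} l (key : X -> nat) :
  primrec l -> primrec key -> primrec (fun x => lookup (l x) (key x)).
Proof. by rewrite /lookup => pl pk; pr. Qed.

(* State, input head, writes on the work tapes (keyed by tape and cell),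
   positions of the work heads, writes on the output tape, output head. *)
Definition sim_state : Type := nat * (nat * (seq (nat * nat) *
  (seq (nat * nat) * (seq (nat * nat) * nat)))).
Definition sim_in (S : sim_state) := S.2.1.
Definition sim_mem (S : sim_state) := S.2.2.1.
Definition sim_heads (S : sim_state) := S.2.2.2.1.
Definition sim_out (S : sim_state) := S.2.2.2.2.1.
Definition sim_pos (S : sim_state) := S.2.2.2.2.2.

Arguments entry : simpl never.

Definition sim_move (m h : nat) : nat :=
  if m == 0 then h.-1 else if m == 1 then h else h.+1.

Definition sim_scan (S : sim_state) (j : nat) : nat :=
  lookup (sim_mem S) (cantor j (lookup (sim_heads S) j)).

(* x is a list of input cells in reverse order, r the code of a rule for k work
   tapes, i the number of a machine. *)
Definition sim_applicable (k : nat) (x : seq nat) (S : sim_state) (r : nat) : bool :=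
  [&& entry r 0 == S.1, entry r 1 == nth 0 (rev x) (sim_in S)
    & all (fun j => entry (entry r 2) j == sim_scan S j) (iota 0 k)].

Definition sim_execute (k : nat) (S : sim_state) (r : nat) : sim_state :=
  (entry r 3, (sim_move (entry r 4) (sim_in S),
  ([seq (cantor j (lookup (sim_heads S) j), entry (entry r 5) j) | j <- iota 0 k]
     ++ sim_mem S,
  ([seq (j, sim_move (entry (entry r 6) j) (lookup (sim_heads S) j)) | j <- iota 0 k]
     ++ sim_heads S,
  (if entry r 7 == 0 then sim_out S else (sim_pos S, (entry r 7).-1) :: sim_out S,
   sim_move (entry r 8) (sim_pos S)))))).

(** Indices are shifted by one, 0 meaning that no rule applies. The right fold lets the first
    applicable rule win. *)
Definition sim_find (i : nat) (x : seq nat) (S : sim_state) : nat :=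
  foldr (fun j n => if sim_applicable (entry i 0) x S (entry (entry i 2) j)
                    then j.+1 else n) 0 (iota 0 (entry i 1)).

Definition sim_step (i : nat) (x : seq nat) (S : sim_state) : sim_state :=
  if sim_find i x S == 0 then S
  else sim_execute (entry i 0) S (entry (entry i 2) (sim_find i x S).-1).

Definition sim_run (i : nat) (x : seq nat) (t : nat) : sim_state :=
  iter t (sim_step i x) (0, (0, ([::], ([::], ([::], 0))))).

Ltac pr_user ::=
  lazymatch goal with
  | |- primrec (fun x => list_code _) => apply: pr_list_code
  | |- primrec (fun x => lookup _ _) => apply: pr_lookup
  end.

Lemma pr_sim_find : primrec (fun w : nat * (seq nat * sim_state) =>
  sim_find w.1 w.2.1 w.2.2).
Proof.
by rewrite /sim_find /sim_applicable /sim_scan /sim_mem /sim_heads /sim_in; pr.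
Qed.

Lemma pr_sim_step : primrec (fun w : nat * (seq nat * sim_state) =>
  sim_step w.1 w.2.1 w.2.2).
Proof.
have pf X (eX : encodable X) (i : X -> nat) (x : X -> seq nat) (S : X -> sim_state) :
  primrec i -> primrec x -> primrec S -> primrec (fun w => sim_find (i w) (x w) (S w)).
  exact: (pr_app3 pr_sim_find).
rewrite /sim_step /sim_execute /sim_mem /sim_heads /sim_in /sim_out /sim_pos /sim_move.
by repeat (pr; apply: pf).
Qed.

Lemma pr_sim_run X {eX : encodable X} (i t : X -> nat) (x : X -> seq nat) :
  primrec i -> primrec x -> primrec t ->
  primrec (fun w => sim_run (i w) (x w) (t w)).
Proof.
move=> p_i px pt; rewrite /sim_run; pr.
by apply: (pr_app3 pr_sim_step); pr.
Qed.

Definition simulates k (S : sim_state) (D : config k) : Prop :=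
  [/\ state D = S.1, in_head D = sim_in S,
   forall j : 'I_k, pos (work D j) = lookup (sim_heads S) j /\
     forall c, cell (work D j) c = lookup (sim_mem S) (cantor j c)
   & pos (out D) = sim_pos S /\ forall c, cell (out D) c = lookup (sim_out S) c].

Lemma sim_moveE m h : sim_move m h = move_head (move_of_nat m) h.
Proof. by case: m => [|[|m]]. Qed.

Lemma lookup_map (s : seq nat) (u v : nat -> nat) (l : seq (nat * nat)) key j :
  injective u -> u j = key ->
  lookup ([seq (u i, v i) | i <- s] ++ l) key =
  if j \in s then v j else lookup l key.
Proof.
move=> uI uj; elim: s => //= i s IH; rewrite inE IH -uj (inj_eq uI) eq_sym.
by case: eqP => [->|].
Qed.

Lemma lookup_work (s : seq nat) (u v : nat -> nat) l j c :
  lookup ([seq (cantor i (u i), v i) | i <- s] ++ l) (cantor j c) =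
  if (j \in s) && (c == u j) then v j else lookup l (cantor j c).
Proof.
have cI a b a' b' : (cantor a b == cantor a' b') = (a == a') && (b == b').
  apply/eqP/andP => [/(congr1 uncantor)|[/eqP-> /eqP->]]//.
  by rewrite !cantorK => -[-> ->]; rewrite !eqxx.
elim: s => //= i s IH; rewrite inE IH cI eq_sym.
by case: eqP => [->|] //=; rewrite eq_sym; case: eqP => //=; rewrite andbF.
Qed.

Lemma ohead_filter_map (T : Type) (R : nat -> T) (a : pred T) (s : seq nat) :
  ohead [seq r <- [seq R j | j <- s] | a r] =
  (let n := foldr (fun j n => if a (R j) then j.+1 else n) 0 s in
   if n == 0 then None else Some (R n.-1)).
Proof. by elim: s => //= j s IH; case: (a (R j)). Qed.

Lemma simulates_applicable k p x (S : sim_state) (D : config k) r :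
  simulates S D -> nth 0 (rev x) (sim_in S) = in_cell p (in_head D) ->
  applicable p D (rule_of_nat k r) = sim_applicable k x S r.
Proof.
move=> [sD hD wD _] xD; rewrite /applicable /sim_applicable /= sD xD.
congr [&& _, _ & _]; apply/forallP/allP => [H j|H j].
  rewrite mem_iota /= => jk; have := H (Ordinal jk); rewrite ffunE.
  by have [pj cj] := wD (Ordinal jk); rewrite /scan pj cj.
rewrite ffunE; have := H j; rewrite mem_iota /= ltn_ord => /(_ isT).
by have [pj cj] := wD j; rewrite /scan pj cj.
Qed.

Lemma simulates_execute k S (D : config k) r : simulates S D ->
  simulates (sim_execute k S r) (execute D (rule_of_nat k r)).
Proof.
move=> [sD hD wD [poD coD]]; split.
- exact: erefl.
- by rewrite /sim_in [LHS]/= [RHS]/= sim_moveE hD.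
- move=> j; have [pj cj] := wD j;
  have jk : (j : nat) \in iota 0 k by rewrite mem_iota /=.
  split.
    by rewrite /sim_heads/= (lookup_map _ _ _ (j := j))// jk pj !ffunE sim_moveE.
  by move=> c; rewrite /sim_mem/= lookup_work jk pj ffunE cj.
- have -> : out (execute D (rule_of_nat k r)) =
    act (option_of_nat (entry r 7)) (move_of_nat (entry r 8)) (out D) by exact: erefl.
  rewrite /sim_pos /sim_out /sim_execute; move: (entry r 7) (entry r 8) => a m.
  split; first by rewrite /= poD -sim_moveE.
  by move=> c; case: a => [|a] /=; rewrite ?poD coD // eq_sym.
Qed.

Lemma simulates_step i p x S D : simulates S D ->
  nth 0 (rev x) (sim_in S) = in_cell p (in_head D) ->
  step (M := machine_of_nat i) p D =
    (if sim_find i x S == 0 then None else Some (execute D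
       (rule_of_nat _ (entry (entry i 2) (sim_find i x S).-1)))) /\
  simulates (sim_step i x S) (odflt D (step (M := machine_of_nat i) p D)).
Proof.
move=> SD xS.
have E : step (M := machine_of_nat i) p D = (if sim_find i x S == 0 then None
    else Some (execute D (rule_of_nat _ (entry (entry i 2) (sim_find i x S).-1)))).
  rewrite /step (ohead_filter_map _ (applicable p D)) /sim_find.
  set n := foldr _ _ _; set n' := foldr _ _ _; suff -> : n = n' by case: (n' == 0).
  rewrite /n /n'; elim: (iota 0 _) => //= j s ->.
  by rewrite (simulates_applicable _ SD xS).
split=> //; rewrite E /sim_step; case: ifP => // _.
exact: simulates_execute.
Qed.

Lemma nth_prefix p t h : h < t -> nth 0 (rev (prefix p t)) h = in_cell p h.
Proof.
elim: t => // t IH; rewrite ltnS leq_eqVlt /= rev_cons nth_rcons size_rev.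
have -> : size (prefix p t) = t by elim: t {IH} => //= t ->.
by case: ltngtP => // [/IH|->].
Qed.

Lemma size_prefix p t : size (prefix p t) = t.
Proof. by elim: t => //= t ->. Qed.

Lemma in_head_run M p t : in_head (run M p t) <= t.
Proof.
elim: t => // t IH; rewrite /run iterS -/(run M p t) /step.
case: ohead => [r|] /=; last exact: leq_trans IH _.
by case: (mv_in r) => /=; lia.
Qed.

(** At time [u] the input head is at most at cell [u], so a prefix of length [t] contains all that
    is read before time [t]. Testing for a halt at time [s] reads once more, hence the strict
    inequality. *)
Lemma sim_runP i p s t : s <= t ->
  simulates (sim_run i (prefix p t) s) (run (machine_of_nat i) p s) /\
  (s < t -> (sim_find i (prefix p t) (sim_run i (prefix p t) s) == 0) =
            ~~ step p (run (machine_of_nat i) p s)).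
Proof.
move=> st.
have inE' u S : u < t -> simulates S (run (machine_of_nat i) p u) ->
    nth 0 (rev (prefix p t)) (sim_in S) = in_cell p (in_head (run (machine_of_nat i) p u)).
  move=> ut [_ <- _ _]; apply: nth_prefix.
  exact: leq_ltn_trans (in_head_run _ _ _) ut.
have sim u : u <= t ->
    simulates (sim_run i (prefix p t) u) (run (machine_of_nat i) p u).
  elim: u => [|u IH] ut; first by split.
  have Su := IH (ltnW ut); rewrite /run iterS -/(run (machine_of_nat i) p u).
  by have [_] := simulates_step Su (inE' _ _ ut Su).
split=> [|st']; first exact: sim.
by have [-> _] := simulates_step (sim _ st) (inE' _ _ st' (sim _ st)); case: eqP.
Qed.

Definition sim_cell (i : nat) (x : seq nat) (t c : nat) : nat :=
  lookup (sim_out (sim_run i x t)) c.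

Lemma pr_sim_cell X {eX : encodable X} (i t c : X -> nat) (x : X -> seq nat) :
  primrec i -> primrec x -> primrec t -> primrec c ->
  primrec (fun w => sim_cell (i w) (x w) (t w) (c w)).
Proof.
move=> p_i px pt pc; apply: pr_lookup => //; rewrite /sim_out.
by do 1?apply: pr_fst; do 4!apply: pr_snd; exact: pr_sim_run.
Qed.

Lemma sim_cellE i p s t c : s <= t ->
  sim_cell i (prefix p t) s c = cell (out (run (machine_of_nat i) p s)) c.
Proof. by move=> st; have [[_ _ _ [_ ->]] _] := sim_runP i p st. Qed.

Definition sim_halted (i : nat) (x : seq nat) : bool :=
  has (fun s => sim_find i x (sim_run i x s) == 0) (iota 0 (size x)).

Lemma pr_sim_halted X {eX : encodable X} (i : X -> nat) (x : X -> seq nat) :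
  primrec i -> primrec x -> primrec (fun w => sim_halted (i w) (x w)).
Proof.
move=> p_i px; rewrite /sim_halted; pr; apply: (pr_app3 pr_sim_find); pr.
by apply: pr_sim_run; pr.
Qed.

Lemma sim_haltedP i p t : reflect
  (exists2 s, s < t & step p (run (machine_of_nat i) p s) = None)
  (sim_halted i (prefix p t)).
Proof.
apply: (iffP hasP) => -[s].
  rewrite mem_iota size_prefix /= => st; have [_ ->//] := sim_runP i p (ltnW st).
  by case E : step => // _; exists s.
move=> st E; exists s; first by rewrite mem_iota size_prefix.
by have [_ ->//] := sim_runP i p (ltnW st); rewrite E.
Qed.

(** * Words and limits *)

Definition eventually (P : nat -> Prop) : Prop := exists t0, forall t, t0 <= t -> P t.

Lemma eventually_and P Q : eventually P -> eventually Q ->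
  eventually (fun t => P t /\ Q t).
Proof.
move=> [s Ps] [t Qt]; exists (maxn s t) => u; rewrite geq_max => /andP[su tu].
by split; [exact: Ps | exact: Qt].
Qed.

Lemma eventually_all (P : nat -> nat -> Prop) n :
  (forall i, i < n -> eventually (P i)) ->
  eventually (fun t => forall i, i < n -> P i t).
Proof.
elim: n => [|n IH] Pi; first by exists 0.
have [t0 H] := eventually_and (IH (fun i h => Pi i (ltnW h))) (Pi n (leqnn _)).
exists t0 => t /H[H1 H2] i; rewrite ltnS leq_eqVlt => /orP[/eqP->|/H1]//.
Qed.

(* Where the code of the n-th entry of q starts in the word of q. *)
Definition start (q : baire) (n : nat) : nat := \sum_(i < n) (q i).+1.

Lemma startS q n : start q n.+1 = (start q n + q n).+1.
Proof. by rewrite /start big_ord_recr /= addnS. Qed.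

Lemma leq_start q n : n <= start q n.
Proof. by elim: n => // n IH; rewrite startS ltnS (leq_trans IH)// leq_addr. Qed.

Lemma start_leq q m n : m <= n -> start q m <= start q n.
Proof.
move=> /subnK<-; elim: (n - m) => // d IH.
by rewrite addSn startS (leq_trans IH)// -addnS leq_addr.
Qed.

Lemma start_offset q m n : m < n -> start q m + q m < start q n.
Proof. by move=> /(start_leq q); rewrite startS. Qed.

Lemma word_sepP q c : reflect (exists n, c = start q n + q n) (word q c == sep).
Proof.
apply: (iffP eqP) => [|[n cE]]; rewrite /word.
  case: ifP => // /existsP[n /eqP E] _.
  by exists n; have := startS q n; rewrite /start -E => -[].
have nc : n < c.+1 by rewrite ltnS cE (leq_trans (leq_start q n))// leq_addr.
by rewrite ifT//; apply/existsP; exists (Ordinal nc) => /=; apply/eqP;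
  rewrite {1}cE -startS.
Qed.

Lemma word_one_sep q c : (word q c == one) = (word q c != sep).
Proof. by rewrite /word; case: ifP. Qed.

Lemma word_sep q n : word q (start q n + q n) = sep.
Proof. by apply/eqP/word_sepP; exists n. Qed.

Lemma word_one q n j : j < q n -> word q (start q n + j) = one.
Proof.
move=> jq; apply/eqP; rewrite word_one_sep; apply/word_sepP => -[m E].
case: (ltngtP m n) => [mn|nm|mn]; last by move: E jq; rewrite mn => /addnI->;
  rewrite ltnn.
- by have := start_offset q mn; lia.
- by have := start_offset q nm; lia.
Qed.

Lemma word_split q c : exists n j, j <= q n /\ c = start q n + j.
Proof.
elim: c => [|c [n [j [jq ->]]]].
  by exists 0, 0; rewrite /start big_ord0.
move: jq; rewrite leq_eqVlt => /orP[/eqP->|jq].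
  by exists n.+1, 0; rewrite startS addn0.
by exists n, j.+1; rewrite addnS.
Qed.

(** If two entries start at the same cell and differ, the separator of the shorter block meets a
    [one] of the longer. *)
Lemma word_inj q q' : word q =1 word q' -> q = q'.
Proof.
move=> E; have qE n : start q n = start q' n -> q n = q' n.
  move=> s; case: (ltngtP (q n) (q' n)) => // h.
  - by have := word_one h; rewrite -s -E word_sep.
  - by have := word_one h; rewrite s E word_sep.
apply/funext => n; apply: (qE); elim: n => [|n IH]; first by rewrite /start !big_ord0.
by rewrite !startS IH (qE n IH).
Qed.

(** Bounded search over lists replaces ordinals, which brings [word] within reach of the closure
    lemmas. *)
Lemma word_has q c : word q c =
  if has (fun n => c.+1 == sumn [seq (q i).+1 | i <- iota 0 n.+1]) (iota 0 c.+1)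
  then sep else one.
Proof.
rewrite /word; congr (if _ then _ else _).
have E n : sumn [seq (q i).+1 | i <- iota 0 n.+1] = \sum_(i < n.+1) (q i).+1.
  by rewrite sumnE big_map -[iota 0 _]/(index_iota 0 n.+1) big_mkord.
apply/existsP/hasP => [[n /eqP nE]|[n]].
  by exists (val n); [rewrite mem_iota /= ltn_ord | rewrite E -nE].
by rewrite mem_iota E => nc nE; exists (Ordinal (nc : n < c.+1)).
Qed.

Lemma word_ext q q' c : (forall i, i <= c -> q i = q' i) -> word q c = word q' c.
Proof.
move=> E; rewrite /word; congr (if _ then _ else _); apply: eq_existsb => n.
congr (_ == _); apply: eq_bigr => i _; rewrite E//.
by rewrite -ltnS (leq_trans (ltn_ord i))// ltn_ord.
Qed.

(** In a complete word this is the index of the entry to which cell [c] belongs. *)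
Definition seps (w : nat -> nat) (c : nat) : nat := count (fun c' => w c' == sep) (iota 0 c).

Lemma sepsS w c : seps w c.+1 = seps w c + (w c == sep).
Proof. by rewrite /seps -[c.+1]addn1 iotaD count_cat /= addn0. Qed.

Lemma seps_leq w c d : c <= d -> seps w c <= seps w d.
Proof.
move=> /subnK<-; elim: (d - c) => // n IH.
by rewrite addSn sepsS (leq_trans IH)// leq_addr.
Qed.

Lemma seps_eq w w' c : (forall d, d < c -> w d = w' d) -> seps w c = seps w' c.
Proof.
move=> E; apply: eq_in_count => d; rewrite mem_iota => /andP[_ dc] /=.
by rewrite E.
Qed.

Lemma seps_word q n j : j <= q n -> seps (word q) (start q n + j) = n.
Proof.
have [c cE] : exists c, start q n + j = c by eexists.
elim: c n j cE => [|c IH] [|n] [|j] cE jq; rewrite ?cE //.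
- by have := leq_start q n.+1; lia.
- by have := leq_start q n.+1; lia.
- by move: cE; rewrite /start big_ord0.
- move: cE; rewrite addnS => -[cE]; rewrite sepsS -cE word_one// IH// ltnW//.
- move: cE; rewrite addn0 startS => -[cE]; rewrite sepsS -cE word_sep IH// addn1//.
- by move: cE; rewrite addnS => -[cE]; rewrite sepsS -cE word_one// IH ?addn0// ltnW.
Qed.

(* Whether the n-th entry of the sequence, whose word has the first L cells w,
   is nonzero. *)
Definition nonzero (w : nat -> nat) (L n : nat) : bool :=
  has (fun c => (w c == one) && (seps w c == n)) (iota 0 L).

(** Cells from [start q n.+1] on may hold anything: more than [n] separators precede them, so they
    are not counted for entry [n]. *)
Lemma nonzero_word (q : baire) w L n : (forall c, c < start q n.+1 -> w c = word q c) ->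
  start q n.+1 <= L -> nonzero w L n = (q n != 0).
Proof.
move=> wq nL; apply/hasP/idP => [[c _ /andP[/eqP w1 /eqP wn]]|q0].
  have cn : c < start q n.+1.
    rewrite ltnNge; apply/negP => /(seps_leq w); rewrite wn (seps_eq wq).
    by rewrite -[start q n.+1]addn0 seps_word// ltnn.
  have E : seps w c = seps (word q) c.
    by apply: seps_eq => d dc; apply: wq; exact: ltn_trans cn.
  have [m [j [jq cE]]] := word_split q c.
  move: wn w1; rewrite E wq// cE seps_word// => <-.
  by case: eqP => // q0; move: jq; rewrite q0 leqn0 => /eqP->;
    have := word_sep q m; rewrite q0 => ->.
exists (start q n); first by rewrite mem_iota/= (leq_trans _ nL)// startS ltnS leq_addr.
have lt0 c : c <= start q n -> c < start q n.+1 by rewrite startS; lia.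
rewrite wq ?lt0// -[start q n]addn0 word_one ?lt0n//=.
rewrite (@seps_eq _ (word q)) ?seps_word// => d; rewrite addn0 => dn.
by apply: wq; rewrite lt0 // ltnW.
Qed.

Lemma pr_seps X {eX : encodable X} (w : X -> nat -> nat) (c : X -> nat) :
  primrec (fun u : X * nat => w u.1 u.2) -> primrec c ->
  primrec (fun x => seps (w x) (c x)).
Proof. by move=> pw pc; rewrite /seps; pr; apply: (pr_app2 pw); pr. Qed.

Lemma pr_nonzero X {eX : encodable X} (w : X -> nat -> nat) (L n : X -> nat) :
  primrec (fun u : X * nat => w u.1 u.2) -> primrec L -> primrec n ->
  primrec (fun x => nonzero (w x) (L x) (n x)).
Proof.
move=> pw pL pn; rewrite /nonzero; pr.
by apply: (pr_seps (w := fun u c => w u.1 c)); pr; apply: (pr_app2 pw); pr.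
Qed.

(* On a partially written tape: the n-th entry is complete. *)
Lemma seps_written (q : baire) w l L n : (forall c, c < l -> w c = word q c) ->
  (forall c, l <= c -> w c = blank) -> (n < seps w L) = (start q n.+1 <= minn l L).
Proof.
move=> wq w0; have -> : seps w L = seps (word q) (minn l L).
  have E : seps w L = seps w (minn l L).
    elim: L => [|L IH]; first by rewrite minn0.
    rewrite sepsS IH; case: (leqP l L) => lL.
      by rewrite w0// addn0; congr seps; lia.
    by rewrite (_ : minn l L.+1 = (minn l L).+1) ?sepsS; [congr (_ + (w _ == _));
      lia|lia].
  by rewrite E; apply: seps_eq => c; rewrite leq_min => /andP[/wq].
apply/idP/idP => [|/(seps_leq (word q))]; last first.
  by rewrite -[start q n.+1]addn0 seps_word.
apply: contraTT; rewrite -!ltnNge startS !ltnS => /(seps_leq (word q)).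
by rewrite seps_word.
Qed.

Local Open Scope classical_set_scope.

(** * Convergence in Baire space *)

Lemma rows_cvgP (r q : baire) : {ptws, rows r @ \oo --> q} <->
  forall i, eventually (fun s => r (cantor s i) = q i).
Proof.
rewrite pointwise_cvgP; split=> H i.
  have /discrete_cvg [t0 _ Ht] := H i.
  by exists t0 => t tt0; exact: Ht tt0.
apply/discrete_cvg; have [t0 Ht] := H i.
by exists t0 => // t /Ht.
Qed.

Lemma limB_Some (r q : baire) : limB r = Some q <->
  forall i, eventually (fun s => r (cantor s i) = q i).
Proof.
have uniq q1 q2 : {ptws, rows r @ \oo --> q1} -> {ptws, rows r @ \oo --> q2} -> q1 = q2.
  move=> /rows_cvgP H1 /rows_cvgP H2; apply/funext => i.
  have [t H] := eventually_and (H1 i) (H2 i).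
  by have [<- <-] := H t (leqnn t).
split=> [|/rows_cvgP rq]; rewrite /limB; last first.
  case: asboolP => [ex|[]]; last by exists q.
  by congr Some; apply: uniq (rq); exact: getPex ex.
case: asboolP => // -[q' rq'] [<-]; apply/rows_cvgP.
by apply: (@getPex _ [set q : baire | {ptws, rows r @ \oo --> q}]); exists q'.
Qed.

Lemma pcomp_Some G F p r : pcomp G F p = Some r ->
  exists2 q, F p = Some q & G q = Some r.
Proof. by rewrite /pcomp; case: (F p) => // q; exists q. Qed.

(** * Limit computability *)

Lemma leq_cantor n k : n + k <= cantor n k.
Proof.
rewrite cantorE (leq_trans _ (leq_addl _ _))//.
by elim: (n + k) => // m IH; rewrite big_ord_recr /= -[m.+1]add1n; lia.
Qed.

(* Along one diagonal of Cantor's enumeration the head moves to the left, and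
   along the next one it writes the approximations of the cells. *)
Theorem limit_computable_approx (F : pfun) (w : seq nat -> nat -> nat) :
  primrec (fun u : seq nat * nat => w u.1 u.2) ->
  (forall p q, F p = Some q ->
     forall c, eventually (fun t => w (prefix p t) c = word q c)) ->
  limit_computable F.
Proof.
move=> pw wF.
pose f (u : nat * seq nat) := let d := uncantor (size u.2).-1 in
  if odd (d.1 + d.2) then if w u.2 d.2 == one then 1 else 2 else 3.
have pf : primrec f by rewrite /f; pr; apply: (pr_app2 pw); pr.
have [h _ hM] := driver_machine false pf.
exists (machine_of_nat (h 0)) => p q Fp c; have [_ /(_ p) [_ outM]] := hM 0.
pose O := output false (fun x => f (0, x)) p.
(* On odd diagonals the head rises with the second coordinate, on even ones it falls with the first.
   The last move of an even diagonal is a [Left] at cell 0, without effect. *)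
have posO m : let d := uncantor m in pos (O m) = if odd (d.1 + d.2) then d.2 else d.1.
  elim: m => // m IH; rewrite -[uncantor m.+1]/(uncantor_next (uncantor m)).
  rewrite /O /= -/(O m) /f /= size_prefix /=.
  move: IH => /=; case: (uncantor m) => -[|a] b /=.
    rewrite add0n addn0 /=; case: (boolP (odd b)) => ob E /=.
      by case: ifP => _ /=; rewrite E.
    by rewrite E.
  by rewrite addnS /=; case: ifP => /= _ E; rewrite ?E //; case: ifP => _ /=; rewrite E.
have [t0 wc] := wF p q Fp c.
have cellO m : t0 <= m -> let d := uncantor m in
    cell (O m.+1) c = if odd (d.1 + d.2) && (d.2 == c) then word q c else cell (O m) c.
  move=> t0m; have := posO m; rewrite {2}/O /= -/(O m) /f /= size_prefix /=.
  case: (uncantor m) => a b /=; case: ifP => //= _ E.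
  case: (b =P c) => [bc|bc]; last first.
    by case: ifP => /= _; rewrite E; case: eqP => // cb; case: bc.
  rewrite bc in E *; have /= -> := wc m.+1 (leqW t0m).
  have [->|->] : word q c = one \/ word q c = sep by rewrite /word; case: ifP;
  [right|left].
    by rewrite /= E eqxx.
  by rewrite /= E eqxx.
have [t1 [t01 odd1 c1]] : exists t1, [/\ t0 <= t1,
    odd ((uncantor t1).1 + (uncantor t1).2) & (uncantor t1).2 = c].
  (* The boolean corrects the parity: stage [cantor n c] then lies on a writing diagonal and visits
     cell [c]. *)
  pose n := t0 + ~~ odd (t0 + c); exists (cantor n c); rewrite cantorK; split=> //.
    by apply: leq_trans (leq_cantor n c); rewrite -addnA leq_addr.
  by rewrite /= /n addnAC oddD oddb addbN addbb.
have stable m : t1 < m -> cell (O m) c = word q c.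
  elim: m => // m IH; rewrite ltnS leq_eqVlt => /orP[/eqP <-|t1m].
    by rewrite cellO//= odd1 c1 eqxx.
  by rewrite cellO ?(leq_trans t01 (ltnW t1m))//= IH// if_same.
have [|t2 H] := outM _ t1.+1.
  by move=> m; rewrite /f /=; case: ifP => // _; case: ifP.
by exists t2 => t /H[m' /stable + ->].
Qed.

Lemma sim_halted_cvg i p :
  eventually (fun t => sim_halted i (prefix p t) = `[< halts (machine_of_nat i) p >]).
Proof.
case: asboolP => [[s hs]|nh].
  by exists s.+1 => t st; apply/sim_haltedP; exists s.
exists 0 => t _; apply/sim_haltedP => -[s _ hs]; apply: nh; by exists s.
Qed.

(** Cell [c] of a word depends on the entries up to [c] only, so finitely many bits have to
    settle. *)
Lemma limit_computable_jump : limit_computable (fun p => Some (jump p)).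
Proof.
pose w (x : seq nat) c := if has (fun n =>
  c.+1 == sumn [seq (sim_halted i x : nat).+1 | i <- iota 0 n.+1]) (iota 0 c.+1)
  then sep else one.
have wE x c : w x c = word (fun i => sim_halted i x) c by rewrite word_has.
apply: (limit_computable_approx (w := w)).
  by rewrite /w; pr; apply: pr_sim_halted; pr.
move=> p _ [<-] c.
have [t0 H] := eventually_all (fun i (_ : i < c.+1) => sim_halted_cvg i p).
by exists t0 => t /H{}H; rewrite wE; apply: word_ext => i ic; rewrite H.
Qed.

(** For each [c] and [a] some machine halts exactly on the inputs whose word has [a] in cell [c], so
    the jump determines the word. The successor skips the blank cell 0 of the input tape. *)
Lemma jump_inj : injective jump.
Proof.
pose f (u : nat * seq nat) := if ((uncantor u.1).1.+1 < size u.2) &&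
  (nth 0 (rev u.2) (uncantor u.1).1.+1 == (uncantor u.1).2) then 4 else 0.
have pf : primrec f by rewrite /f; pr.
have [h _ hM] := driver_machine false pf.
have jumpE p c a : jump p (h (cantor c a)) = (word p c == a).
  rewrite /jump; congr nat_of_bool; have [_ /(_ p) [haltsE _]] := hM (cantor c a).
  apply/asboolP/idP => [/haltsE[m]|/eqP wc].
    rewrite /f cantorK size_prefix; case: ifP => // /andP[cm].
    by rewrite nth_prefix.
  apply/haltsE; exists c.+1; rewrite /f cantorK size_prefix /= ltnS leqnn /=.
  by rewrite (nth_prefix p (leqnn c.+2)) /= wc eqxx.
move=> p p' E; apply: word_inj => c; apply/esym/eqP.
have := jumpE p' c (word p c); rewrite -E jumpE eqxx => /eqP.
by rewrite eq_sym eqb1.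
Qed.

Lemma partial_inverse_jump (q : baire) (r : baire) :
  partial_inverse jump r = Some q <-> jump q = r.
Proof.
rewrite /partial_inverse; split=> [|<-]; case: asboolP => [ex|nex] //.
- by move=> [<-]; exact: (getPex ex).
- by congr Some; apply: jump_inj; exact: (getPex ex).
- by case: nex; exists q.
Qed.

Lemma lowmap_Some r q : lowmap r = Some q <->
  forall i, eventually (fun s => r (cantor s i) = jump q i).
Proof.
split=> [/pcomp_Some[l /limB_Some H /partial_inverse_jump ->]|/limB_Some H]//.
by rewrite /lowmap /pcomp H /=; apply/partial_inverse_jump.
Qed.

(** * One-way machines *)

Lemma one_way_cell M p t : one_way M ->
  let T := out (run M p t) in forall c,
  (pos T <= c -> cell T c = blank) /\
  (c < pos T -> forall t', t <= t' -> cell (out (run M p t')) c = cell T c).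
Proof.
move=> /allP oM.
have stepE u : out (run M p u.+1) = out (run M p u) \/ exists a,
    out (run M p u.+1) = act (Some a) Right (out (run M p u)).
  rewrite /run iterS -/(run M p u) /step.
  case E : [seq _ <- _ | _] => [|r s]; first by left.
  have : r \in [seq r <- rules M | applicable p (run M p u) r] by rewrite E mem_head.
  rewrite mem_filter => /andP[_ /oM] /=.
  case: (wr_out r) (mv_out r) => [a|] [] // _; first by right; exists a.
  by left; rewrite act_stay.
move=> T c; split.
  rewrite /T; elim: t {T} => // t; have [->|[a ->]] // := stepE t.
  by move=> IH /= tc; rewrite gtn_eqF// IH// ltnW.
move=> cT t' /subnK<-; elim: (t' - t) => // d IH; rewrite addSn -IH.
have [->|[a ->]] // := stepE (d + t).
have : pos T <= pos (out (run M p (d + t))).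
  rewrite /T; elim: d {IH} => // d IH; rewrite addSn.
  by have [->|[a' ->]] // := stepE (d + t); rewrite (leq_trans IH) //= leqnSn.
by move=> le; rewrite /= ltn_eqF// (leq_trans cT).
Qed.

Lemma one_way_written M (F : pfun) p q t : one_way M -> produces M F -> F p = Some q ->
  let T := out (run M p t) in forall c,
  (pos T <= c -> cell T c = blank) /\ (c < pos T -> cell T c = word q c).
Proof.
move=> oM MF Fp T c; have [H1 H2] := one_way_cell p t oM c; split=> // cT.
have [t0 H] := MF p q Fp c.
by rewrite -(H2 cT (maxn t t0)) ?leq_maxl// H// leq_maxr.
Qed.

(** A word contains no blank, while the cells from the head on are blank; so the head passes every
    cell. *)
Lemma one_way_pos M (F : pfun) p q : one_way M -> produces M F -> F p = Some q ->
  forall n, eventually (fun t => n <= pos (out (run M p t))).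
Proof.
move=> oM MF Fp [|n]; first by exists 0.
have [t0 H] := MF p q Fp n; exists t0 => t tt0; rewrite ltnNge; apply/negP => npos.
have [/(_ npos) + _] := one_way_cell p t oM n.
by rewrite H// /word; case: ifP.
Qed.

(** Each bit takes two stages: the even one prints a [one] or nothing, the odd one the separator.
    [D] cuts out the domain. *)
Lemma computable_bits (b : seq nat -> nat -> bool) (r : baire -> baire) (D : pfun) :
  primrec (fun u : seq nat * nat => b u.1 u.2) ->
  (forall p n t, n <= t -> r p n = b (prefix p t) n) ->
  computable (fun p => if D p is Some _ then Some (r p) else None).
Proof.
move=> pb rE.
pose f (u : nat * seq nat) := let t := (size u.2).-1 in
  if odd t then 2 else if b u.2 t./2 then 1 else 0.
have pf : primrec f by rewrite /f; pr; apply: (pr_app2 pb); pr.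
have [h _ hM] := driver_machine true pf.
have [oM /(_ _)/proj2] := hM 0; move=> outM.
exists (machine_of_nat (h 0)); first exact: oM.
move=> p q; case: (D p) => // _ [<-] c.
pose O := output true (fun x => f (0, x)) p.
have O_written m : pos (O m) = start (r p) m./2 + odd m * r p m./2 /\
    forall d, d < pos (O m) -> cell (O m) d = word (r p) d.
  elim: m => [|m [posO cellO]].
    by rewrite /start big_ord0; split.
  have rm : r p m./2 = b (prefix p m.+1) m./2.
    by apply: rE; rewrite leqW// -{2}(odd_double_half m) -addnn addnA leq_addl.
  rewrite /O /= -/(O m) /f /= size_prefix /=.
  rewrite uphalf_half; case: (odd m) posO => /= posO.
    rewrite add1n startS; rewrite mul1n in posO; rewrite posO mul0n addn0; split=> // d.
    rewrite ltnS leq_eqVlt => /orP[/eqP->|dp]; first by rewrite eqxx word_sep.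
    by rewrite ltn_eqF// cellO// posO.
  rewrite mul0n addn0 in posO; rewrite add0n mul1n rm.
  case: ifP => bm /=; last by rewrite addn0; split=> // d dp; rewrite cellO.
  rewrite addn1; split=> [|d]; first by rewrite posO.
  rewrite ltnS leq_eqVlt => /orP[/eqP->|dp]; last by rewrite ltn_eqF// cellO.
  by rewrite eqxx posO -[start _ _]addn0 word_one// rm bm.
have [|t0 H] := outM p _ c.+1.*2.
  by move=> m; rewrite /f /=; case: ifP => // _; case: ifP.
exists t0 => t /H[m cm ->]; have [posO ->] // := O_written m; rewrite posO.
have cm2 : c < m./2 by rewrite -(doubleK c.+1) half_leq.
by rewrite (leq_trans cm2)// (leq_trans (leq_start (r p) _))// leq_addr.
Qed.

(** * Lowness and limit computable functions *)

Lemma low_of_limit_computable_jump F :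
  limit_computable (pcomp (fun p => Some (jump p)) F) -> low F.
Proof.
move=> [M]; have [i <-] := machine_of_nat_onto M => MF.
pose cells x s := sim_cell i x s.
(* Row [s] shows what the first [s] cells of the output say at time [s], so [u.1] is both a time and
   a number of cells. It is at most [n], and a prefix of length [n] suffices. *)
pose bit x n := let u := uncantor n in nonzero (cells x u.1) u.1 u.2.
pose r p n : nat := bit (prefix p n) n.
have rE p n t : n <= t -> r p n = bit (prefix p t) n.
  move=> nt; rewrite /r /bit; congr nat_of_bool.
  have un : (uncantor n).1 <= n.
    by rewrite -{2}(uncantorK n) (leq_trans _ (leq_cantor _ _))// leq_addr.
  congr nonzero; apply/funext => c.
  by rewrite /cells !sim_cellE// (leq_trans un).
(* Outside the domain of [F] the rows might still converge to some jump; the restriction makes the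
   two partial functions equal. *)
exists (fun p => if F p is Some _ then Some (r p) else None).
  apply: computable_bits rE; rewrite /bit /cells.
  apply: (pr_nonzero (w := fun x => sim_cell i x.1 (uncantor x.2).1)); pr.
  by apply: pr_sim_cell; pr.
move=> p; rewrite /pcomp; case Fp : (F p) => [q|]//=; apply/esym/lowmap_Some => k.
have conv c := MF p (jump q) _ c; rewrite /pcomp Fp in conv.
have [t0 H] := eventually_all (fun c (_ : c < start (jump q) k.+1) => conv erefl c).
exists (maxn t0 (start (jump q) k.+1)) => s; rewrite geq_max => /andP[ts ks].
rewrite (rE _ _ (maxn s (cantor s k))) ?leq_maxr// /bit cantorK /=.
rewrite (@nonzero_word (jump q))//; first by rewrite /jump; case: asboolP.
by move=> c cs; rewrite /cells sim_cellE ?leq_maxl// H.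
Qed.

Section LowLimit.
Variables (k : nat) (K F : pfun).
Hypothesis K_one_way : one_way (machine_of_nat k).
Hypothesis K_produces : produces (machine_of_nat k) K.
Hypothesis FK : F =1 pcomp lowmap K.

Let cells x := sim_cell k x (size x).

(* The approximation of bit i of the jump that is read off the last row whose
   i-th entry has been output. *)
Definition jump_approx (x : seq nat) (i : nat) : bool :=
  foldl (fun b s => if cantor s i < seps (cells x) (size x)
    then nonzero (cells x) (size x) (cantor s i) else b) false (iota 0 (size x)).

Lemma pr_jump_approx : primrec (fun u : seq nat * nat => jump_approx u.1 u.2).
Proof.
rewrite /jump_approx; pr.
- by apply: (pr_seps (w := fun u => cells u.1.1)); rewrite /cells; pr;
  apply: pr_sim_cell; pr.
- by apply: (pr_nonzero (w := fun u => cells u.1.1)); rewrite /cells; pr;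
  apply: pr_sim_cell; pr.
Qed.

Lemma foldl_last (a v : nat -> bool) b s0 n : s0 < n -> a s0 -> 
  (forall s, s0 <= s -> a s -> v s = b) ->
  foldl (fun b s => if a s then v s else b) false (iota 0 n) = b.
Proof.
move=> + a0 av; elim: n => // n IH;
  rewrite ltnS leq_eqVlt -[n.+1]addn1 iotaD foldl_cat /= add0n.
move=> /orP[/eqP <-|s0n]; first by rewrite a0 av.
by case: ifP => [/av->//|_]; [exact: ltnW | exact: IH].
Qed.

(** From row [s0] on the rows are right at [i]. Once that entry of row [s0] has been written, the
    last row available is [s0] or a later one. *)
Lemma jump_approx_cvg p q i : F p = Some q ->
  eventually (fun t => jump_approx (prefix p t) i = (jump q i != 0)).
Proof.
rewrite FK => /pcomp_Some[r Kp /lowmap_Some/(_ i)[s0 rs]].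
have [t0 H] := one_way_pos K_one_way K_produces Kp (start r (cantor s0 i).+1).
exists (maxn s0.+1 (maxn t0 (start r (cantor s0 i).+1))) => t.
rewrite !geq_max => /and3P[st tt rt]; rewrite /jump_approx size_prefix.
have written := one_way_written t K_one_way K_produces Kp.
set T := out _ in written; have cellsE c : cells (prefix p t) c = cell T c.
  by rewrite /cells size_prefix sim_cellE.
have avail n : (n < seps (cells (prefix p t)) t) = (start r n.+1 <= minn (pos T) t).
  apply: seps_written => c cT; rewrite cellsE; have [w0 ww] := written c;
    [exact: ww|exact: w0].
apply: (foldl_last (s0 := s0)) => //; first by rewrite avail leq_min H.
move=> s ss; rewrite avail leq_min => /andP[sT s_t].
rewrite (@nonzero_word r) ?rs// => c cs; rewrite cellsE.
by have [_ ->] := written c; rewrite // (leq_trans cs).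
Qed.

Lemma limit_computable_pcomp G : limit_computable G -> limit_computable (pcomp G F).
Proof.
move=> [M]; have [g <-] := machine_of_nat_onto M => MG.
pose f (u : nat * seq nat) := let n := uncantor u.1 in let m := uncantor n.2 in
  if (m.1 <= size u.2) && (sim_cell g u.2 (size u.2) n.1 != m.2) then 4 else 0.
have pf : primrec f by rewrite /f; pr; apply: pr_sim_cell; pr.
have [h ph hM] := driver_machine false pf.
(* Here [m] codes a pair of a time and a symbol. Times appear as successors because the driver first
   evaluates [f] after reading one cell. *)
have jumpP q c m : jump q (h (cantor c m)) = 0 <-> forall t, (uncantor m).1 <= t.+1 ->
    cell (out (run (machine_of_nat g) q t.+1)) c = (uncantor m).2.
  rewrite /jump; have [_ /(_ q) [haltsE _]] := hM (cantor c m).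
  have fE t : 4 <= f (cantor c m, prefix q t.+1) <-> (uncantor m).1 <= t.+1 /\
      cell (out (run (machine_of_nat g) q t.+1)) c <> (uncantor m).2.
    rewrite /f cantorK size_prefix sim_cellE//.
    by case: ifP => [/andP[-> /eqP]|H]; split=> // -[H1 /eqP H2]; rewrite H1 H2 in H.
  case: asboolP => [/haltsE[t /fE[H1 H2]]|nh]; split=> //.
    by move/(_ t H1).
  move=> _ t H1; apply: contrapT => H2; apply: nh; apply/haltsE; exists t.
  exact/fE.
(* The fold returns the symbol of the first [m] whose approximated bit is 0, or the blank if there
   is none yet. *)
pose w x c := foldr (fun m v => if jump_approx x (h (cantor c m)) then v
  else (uncantor m).2) 0 (iota 0 (size x)).
apply: (limit_computable_approx (w := w)).
  by rewrite /w; pr; apply: (pr_app2 pr_jump_approx); pr.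
move=> p r /pcomp_Some[q Fp Gq] c.
have [t0 Hc] := MG q r Gq c.
have ex : exists m, jump q (h (cantor c m)) == 0.
  exists (cantor t0 (word r c)); apply/eqP/jumpP => t; rewrite cantorK; exact: Hc.
case: (@ex_minnP (fun m => jump q (h (cantor c m)) == 0) ex) => m /eqP m0 mmin.
(* Any [m] with bit 0 carries the right symbol: beyond both its own time and [t0] the cell equals
   that symbol and [word r c]. *)
have mE : (uncantor m).2 = word r c.
  move/jumpP: m0 => /(_ (maxn t0 (uncantor m).1)) <-; last by rewrite leqW// leq_maxr.
  by apply: Hc; rewrite leqW// leq_maxl.
(* Only the bits up to the least [m] have to settle, those before it to 1 and its own to 0. *)
have [t1 H] := eventually_all (fun m' (_ : m' < m.+1) =>
  jump_approx_cvg (h (cantor c m')) Fp).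
exists (maxn t1 m.+1) => t; rewrite geq_max => /andP[/H{}H mt].
have iotaE : iota 0 t = iota 0 m ++ m :: iota m.+1 (t - m.+1).
  by rewrite -{1}(subnKC mt) addSnnS iotaD /= add0n.
rewrite /w size_prefix iotaE foldr_cat /=.
rewrite H// m0 /= mE.
have : all (fun m' => jump_approx (prefix p t) (h (cantor c m'))) (iota 0 m).
  apply/allP => m'; rewrite mem_iota /= add0n => mm; rewrite H ?ltnS ?(ltnW mm)//.
  by apply/negP => /mmin; rewrite leqNgt mm.
by elim: (iota 0 m) => //= m' s IH /andP[-> /IH].
Qed.
End LowLimit.

Theorem corollary2p28 (F : pfun) :
  low F <->
  forall G : pfun, limit_computable G -> limit_computable (pcomp G F).
Proof.
split=> [[K [M oM MK] FK] G|H].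
  by have [k kM] := machine_of_nat_onto M; rewrite -kM in oM MK *;
     exact: limit_computable_pcomp oM MK FK _.
by apply: low_of_limit_computable_jump; apply: H; exact: limit_computable_jump.
Qed.
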